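(* Let $\{z_1,\dots,z_m\}$ be a finite set of points in $\mathcal{Z}$ such that $z_i\neq z_j$ and $z_i\ne\bar z_j$ for all $i\neq j$, and for $i=1,\dots,m$ let $h_{z_i,\pi_i}(\lambda)$ be an extended $1$-soliton solution whose associated $1$-soliton Ward map is doubly periodic, i.e. $2\pi$-periodic in $x$ and $2\pi$-periodic in $y$. Let $T_i=T(z_i)$. Let $J_1$ be the Ward map associated to $h_{z_1,\pi_1}$, and let $$J_m=h_{z_m,\pi_m}*(\cdots*(h_{z_2,\pi_2}*J_1)\cdots)$$ be the Ward map obtained by applying $m-1$ Bäcklund transformations to $J_1$. If $T_j/T_1$ is a rational number for every $2\le j\le m$, then $J_m$ is a Ward map from $T^2\times\mathbb{R}$ to $SU(n)$ (i.e. it is $2\pi$-periodic in $x$ and in $y$) and is periodic in time. In other words, $J_m$ is a triply periodic solution of the Ward equation.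
   Context: A Ward map is a smooth map $J$ from $\mathbb{R}^{2,1}$ (coordinates $x,y,t$) to $SU(n)$ satisfying the Ward equation $$(J^{-1}J_t)_t-(J^{-1}J_x)_x-(J^{-1}J_y)_y-[J^{-1}J_t,J^{-1}J_y]=0 .$$ Here $T^2=\mathbb{R}^2/2\pi\mathbb{Z}^2$ in the variables $(x,y)$. Set $u=\frac{t+y}{2}$, $v=\frac{t-y}{2}$. An extended Ward map (extended solution) is a map $\psi(x,y,t,\lambda)\in GL(n,\mathbb{C})$ such that $(\lambda\psi_x-\psi_u)\psi^{-1}$ and $(\lambda\psi_v-\psi_x)\psi^{-1}$ are independent of $\lambda$ and $\psi(x,y,t,\bar\lambda)^*\psi(x,y,t,\lambda)=I$; the associated Ward map is $\psi(\cdot,0)^{-1}$, multiplied by a constant of modulus $1$ to make its determinant $1$. For a Hermitian projection $\pi$ of $\mathbb{C}^n$, $\pi^\perp=I-\pi$ and $h_{z,\pi}(\lambda)=\pi^\perp+\frac{\lambda-z}{\lambda-\bar z}\pi$. An extended $1$-soliton solution is $h_{z,\pi(x,y,t)}(\lambda)$, where $z\in\mathbb{C}\setminus\mathbb{R}$ and $\pi(x,y,t)$ is the Hermitian projection onto the span of the columns of $V(w)$, $w=x+zu+z^{-1}v$, with $V$ a meromorphic map from $\mathbb{C}$ to the rank $k$ complex $n\times k$ matrices (the column span being extended holomorphically across the isolated exceptional points, so that $\pi$ is smooth). Its associated $1$-soliton Ward map is $\left(\frac{z}{\bar z}\right)^{k/n}\left(\pi^\perp+\frac{\bar z}{z}\pi\right)$,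 with any fixed choice of the $n$-th root. Bäcklund transformation: if $\psi$ is an extended solution that is holomorphic and non-degenerate at $\lambda=z$, and $h_{z,\pi}$ is an extended $1$-soliton solution, let $\tilde\pi(x,y,t)$ be the Hermitian projection onto $\psi(x,y,t,z)\,\mathrm{Im}(\pi(x,y,t))$. Then $h_{z,\pi}*\psi:=h_{z,\tilde\pi}\psi$ is again an extended solution, and the corresponding new Ward map is $h_{z,\pi}*J:=\left(\frac{z}{\bar z}\right)^{k/n}J\left(\frac{\bar z}{z}\tilde\pi+\tilde\pi^\perp\right)$, where $J$ is the Ward map associated to $\psi$. The iterated expression for $J_m$ is formed using the extended solutions $\psi_1=h_{z_1,\pi_1}$, $\psi_i=h_{z_i,\pi_i}*\psi_{i-1}$. $\mathcal{Z}$ is the set of $z=re^{i\theta}\in\mathbb{C}\setminus\mathbb{R}$ ($r>0$) such that either $r=1$ and $z\neq\pm i$, or $r\neq1$ and $\frac{\cos\theta}{r-r^{-1}}\in\mathbb{Q}$. The function $T:\mathcal{Z}\to\mathbb{R}$ is defined by $T(z)=\frac{2\pi}{\cos\theta}$ if $z=e^{i\theta}\neq\pm i$, and $T(z)=\frac{2\pi m_2(r+r^{-1})}{r-r^{-1}}$ if $r\neq1$ and $\frac{2\cos\theta}{r-r^{-1}}=\frac{m_1}{m_2}$ in lowest terms with $m_2>0$. *)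

(* Defs.v *)
From HB Require Import structures.
From mathcomp Require Import all_boot all_order all_algebra.
From mathcomp Require Import sesquilinear spectral.
From mathcomp Require Import complex.
From mathcomp Require Import all_classical all_reals all_analysis.
Set Implicit Arguments.
Unset Strict Implicit.
Unset Printing Implicit Defensive.
Import Order.TTheory GRing.Theory Num.Theory.
Import numFieldNormedType.Exports.
Local Open Scope classical_set_scope.
Local Open Scope ring_scope.
Local Open Scope sesquilinear_scope.

(* Points of R^{2,1} are row vectors (x, y, t). *)
Notation spacetime R := 'rV[R]_3.
Definition ix : 'I_3 := 0.
Definition iy : 'I_3 := 1.
Definition it : 'I_3 := 2.

Section Smooth.
Variable R : realType.
Implicit Type p : spacetime R.

Definition dir (mu : 'I_3) : spacetime R := delta_mx 0 mu.

Fixpoint class_C (k : nat) (f : spacetime R -> R) : Prop :=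
  continuous f /\
  if k is k'.+1 then
    forall mu : 'I_3, (forall p, derivable f p (dir mu)) /\
                      class_C k' ('D_(dir mu) f)
  else True.

Definition smooth (f : spacetime R -> R) : Prop := forall k, class_C k f.

Definition smooth_mx m n (F : spacetime R -> 'M[R[i]]_(m, n)) : Prop :=
  forall a b, smooth (fun p => complex.Re (F p a b)) /\
              smooth (fun p => complex.Im (F p a b)).

Definition pderiv m n (mu : 'I_3) (F : spacetime R -> 'M[R[i]]_(m, n)) :
    spacetime R -> 'M[R[i]]_(m, n) :=
  fun p => \matrix_(a, b)
    Complex ('D_(dir mu) (fun q => complex.Re (F q a b)) p)
            ('D_(dir mu) (fun q => complex.Im (F q a b)) p).

Definition periodic_along (T : Type) (f : spacetime R -> T) (mu : 'I_3)
    (c : R) : Prop :=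
  forall p, f (p + c *: dir mu) = f p.

End Smooth.

Section Ward.
Variables (R : realType) (n : nat).
Implicit Type J : spacetime R -> 'M[R[i]]_n.

Definition logderiv (mu : 'I_3) J : spacetime R -> 'M[R[i]]_n :=
  fun p => invmx (J p) *m pderiv mu J p.

Definition ward_equation J : Prop := forall p,
  let Jt := logderiv it J in let Jx := logderiv ix J in
  let Jy := logderiv iy J in
  pderiv it Jt p - pderiv ix Jx p - pderiv iy Jy p
    - (Jt p *m Jy p - Jy p *m Jt p) = 0.

Definition SU : set 'M[R[i]]_n := [set M | M \is unitarymx /\ \det M = 1].

Definition ward_map J : Prop :=
  [/\ smooth_mx J, forall p, SU (J p) & ward_equation J].

End Ward.

(* Hermitian projection of K^n (column vectors) onto the column span of A;
   [proj_ortho] acts on row vectors, whence the transpositions. *)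
Definition hproj (K : numClosedFieldType) n m (A : 'M[K]_(n, m)) : 'M[K]_n :=
  (proj_ortho A^T)^T.

Lemma hprojP (K : numClosedFieldType) n m (A : 'M[K]_(n, m)) :
  [/\ (hproj A)^t* = hproj A, hproj A *m hproj A = hproj A &
      ((hproj A)^T == A^T)%MS].
Proof.
set Q := proj_ortho A^T; have hprojE : hproj A = Q^T by [].
have QQ : Q *m Q = Q by exact: proj_ortho_proj.
have QhE : Q^t* = Q *m Q^t*.
  apply/subr0_eq; rewrite -[X in X - _]mul1mx -mulmxBl; apply/orthomx1P.
  have := proj_ortho_compl_sub A^T 1%:M; rewrite mul1mx => /submx_trans; apply.
  by rewrite submx_ortho proj_orthoE.
have Qh : Q^t* = Q.
  have QhhE : (Q^t*)^t* = (Q^t*)^t* *m Q^t*.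
    by rewrite [in LHS]QhE trmx_mul map_mxM.
  by rewrite trmxCK in QhhE; rewrite QhE -QhhE.
split; first by rewrite hprojE -[in RHS]Qh; apply/matrixP => i j; rewrite !mxE.
- by rewrite hprojE -trmx_mul QQ.
- by rewrite hprojE trmxK; apply/eqmxP; exact: proj_orthoE.
Qed.

Section Meromorphic.
(* To be used with K := R[i]; [derivable] is then complex differentiability. *)
Variables (K : numClosedFieldType) (n k : nat).
Implicit Types (F V : K -> 'M[K]_(n, k)) (a : K).

Definition holomorphic_near F a : Prop :=
  \forall w \near a, forall i j, derivable (fun s : K => F s i j) w 1.

(* The value of a meromorphic map at a pole is irrelevant. *)
Definition meromorphic V : Prop :=
  forall a, exists (N : nat) (G : K -> 'M[K]_(n, k)),
    holomorphic_near G a /\ \forall w \near a^', V w = (w - a) ^- N *: G w.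

Definition generic_rank_k V : Prop :=
  forall a, \forall w \near a^', \rank (V w) = k.

(* P(w) is the Hermitian projection onto the column span of V(w), the latter
   being extended across the isolated exceptional points of V (poles and points
   of rank < k) by local holomorphic frames F of rank k. *)
Definition span_projection V (P : K -> 'M[K]_n) : Prop :=
  forall a, exists F : K -> 'M[K]_(n, k),
    [/\ holomorphic_near F a,
        \forall w \near a, \rank (F w) = k,
        \forall w \near a^', ((F w)^T == (V w)^T)%MS &
        \forall w \near a, P w = hproj (F w)].

End Meromorphic.

Section Soliton.
Variables (R : realType) (n : nat).
Local Notation C := (R[i]).
Implicit Types (z : C) (p : spacetime R).

(* h_{z,prj}(lambda) *)
Definition hfactor z (P : 'M[C]_n) (lambda : C) : 'M[C]_n :=
  (1%:M - P) + ((lambda - z) / (lambda - z^*)) *: P.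

(* w = x + z u + z^-1 v with u = (t + y) / 2, v = (t - y) / 2 *)
Definition wcoord z p : C :=
  let x := p 0 ix in let y := p 0 iy in let t := p 0 it in
  (x%:C + z * ((t + y) / 2)%:C + z^-1 * ((t - y) / 2)%:C)%C.

Definition extended_1soliton (k : nat) z (prj : spacetime R -> 'M[C]_n) : Prop :=
  complex.Im z != 0 /\
  exists (V : C -> 'M[C]_(n, k)) (P : C -> 'M[C]_n),
  [/\ meromorphic V, generic_rank_k V, span_projection V P,
      forall p, prj p = P (wcoord z p) & smooth_mx prj].

(* c is the chosen value of (z / z^* )^(k/n) *)
Definition soliton_map (c : C) z (prj : spacetime R -> 'M[C]_n) :
    spacetime R -> 'M[C]_n :=
  fun p => c *: ((1%:M - prj p) + (z^* / z) *: prj p).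

Definition ptilde z (prj : spacetime R -> 'M[C]_n)
    (psi : spacetime R -> C -> 'M[C]_n) : spacetime R -> 'M[C]_n :=
  fun p => hproj (psi p z *m prj p).

(* h_{z,prj} * psi *)
Definition backlund_ext z prj psi : spacetime R -> C -> 'M[C]_n :=
  fun p lambda => hfactor z (ptilde z prj psi p) lambda *m psi p lambda.

(* h_{z,prj} * J, where J is the Ward map associated to psi *)
Definition backlund_map (c : C) z prj psi (J : spacetime R -> 'M[C]_n) :
    spacetime R -> 'M[C]_n :=
  fun p => c *: (J p *m ((z^* / z) *: ptilde z prj psi p
                         + (1%:M - ptilde z prj psi p))).

Fixpoint ext_iter (z : nat -> C) (prj : nat -> spacetime R -> 'M[C]_n)
    (i : nat) : spacetime R -> C -> 'M[C]_n :=
  if i is j.+1 then backlund_ext (z i) (prj i) (ext_iter z prj j)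
  else fun p lambda => hfactor (z 0%N) (prj 0%N p) lambda.

Fixpoint ward_iter (c z : nat -> C) (prj : nat -> spacetime R -> 'M[C]_n)
    (i : nat) : spacetime R -> 'M[C]_n :=
  if i is j.+1 then
    backlund_map (c i) (z i) (prj i) (ext_iter z prj j) (ward_iter c z prj j)
  else soliton_map (c 0%N) (z 0%N) (prj 0%N).

End Soliton.

Section Period.
Variable R : realType.
Implicit Type z : R[i].

(* z = r e^{i theta} with r = modulus z and cos theta = cosarg z *)
Definition modulus z : R := complex.Re `|z|.
Definition cosarg z : R := complex.Re z / modulus z.

Definition calZ : set R[i] := [set z | complex.Im z != 0 /\
  let r := modulus z in
  (r = 1 /\ z <> Complex 0 1 /\ z <> Complex 0 (-1)) \/
  (r <> 1 /\ rational (cosarg z / (r - r^-1)))].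

(* the rational number equal to a, if any *)
Definition rat_of (a : R) : rat := xget 0 [set q : rat | ratr q = a].

Definition period z : R :=
  let r := modulus z in
  if r == 1 then 2 * pi / cosarg z
  else let m2 := denq (rat_of (2 * cosarg z / (r - r^-1))) in
       2 * pi * m2%:~R * (r + r^-1) / (r - r^-1).

End Period.

(* Main.v *)
Require Import Defs.
From mathcomp Require Import all_boot all_order all_algebra.
From mathcomp Require Import sesquilinear spectral complex.
From mathcomp Require Import all_classical all_reals all_analysis.
From mathcomp Require Import ring.
Set Implicit Arguments.
Unset Strict Implicit.
Unset Printing Implicit Defensive.
Import Order.TTheory GRing.Theory Num.Theory.
Import numFieldNormedType.Exports.
Local Open Scope classical_set_scope.
Local Open Scope ring_scope.
Local Open Scope sesquilinear_scope.

(* The iterated extended solution [psi] tends to [1] as [lambda] goes to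
   infinity; let [Phi], skew-Hermitian, be its [1/lambda] coefficient
   [\sum_i (z_i^* - z_i) ptilde_i].  Then
     lambda psi_x - psi_u = Phi_x psi   and   lambda psi_v - psi_x = Phi_v psi.
   Both are preserved by a Backlund transformation because the fields
   [z d_x - d_u] and [z d_v - d_x] annihilate [w], hence the holomorphic frames
   of the soliton.  At [lambda = 0] they read [J^-1 J_u = Phi_x] and
   [J^-1 J_x = Phi_v], and the Ward equation becomes [Phi_xv = Phi_vx].

   For the periods, [psi] and [J] at a point only depend on the values of the
   [pi_i] there, and [pi_i] depends on [w] alone.  The double periodicity of the
   i-th soliton says that [pi_i] is invariant under the lattice spanned by
   [2 pi] and [pi (z_i - 1/z_i)]; the time shift by [T_i] moves [w] by
   [T_i (z_i + 1/z_i) / 2], which lies in that lattice. *)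

(** * Smooth real functions *)

Section SmoothFunctions.
Variable R : realType.
Implicit Types (f g : spacetime R -> R) (p : spacetime R).

Lemma class_C_continuous k f : class_C k f -> continuous f.
Proof. by case: k => [|k] []. Qed.

Lemma class_CS k f : class_C k.+1 f -> class_C k f.
Proof.
elim: k f => [|k IH] f [cf df]; first by split.
by split=> // mu; have [dfmu /IH] := df mu.
Qed.

Lemma class_C_cst k (a : R) : class_C k (fun _ : spacetime R => a).
Proof.
elim: k a => [|k IH] a; split=> //; try exact: cst_continuous.
move=> mu; split=> [p|]; first exact: derivable_cst.
suff -> : 'D_(dir R mu) (fun _ : spacetime R => a) = fun=> 0 by [].
by apply/funext => p; exact: derive_cst.
Qed.

Lemma class_CD k f g :
  class_C k f -> class_C k g -> class_C k (fun p => f p + g p).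
Proof.
elim: k f g => [|k IH] f g [cf df] [cg dg]; split=> //;
  try by move=> p; apply: continuousD; [exact: cf|exact: cg].
move=> mu; have [dfmu Cf] := df mu; have [dgmu Cg] := dg mu.
split=> [p|]; first exact: derivableD.
suff -> : 'D_(dir R mu) (fun p => f p + g p) =
          fun p => 'D_(dir R mu) f p + 'D_(dir R mu) g p by exact: IH.
by apply/funext => p; exact: deriveD.
Qed.

Lemma class_CM k f g :
  class_C k f -> class_C k g -> class_C k (fun p => f p * g p).
Proof.
elim: k f g => [|k IH] f g Ckf Ckg; have [cf df] := Ckf;
  have [cg dg] := Ckg; split=> //;
  try by move=> p; apply: continuousM; [exact: cf|exact: cg].
move=> mu; have [dfmu Cf] := df mu; have [dgmu Cg] := dg mu.
split=> [p|]; first exact: derivableM.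
suff -> : 'D_(dir R mu) (fun p => f p * g p) =
          fun p => f p * 'D_(dir R mu) g p + g p * 'D_(dir R mu) f p.
  by apply: class_CD; apply: IH => //; exact: class_CS.
by apply/funext => p; exact: deriveM.
Qed.

(** The derivative of [1/f] is [- (1/f) (1/f) f'], a product of functions of class one order lower,
    so the induction runs with [f] fixed. *)
Lemma class_CV k f : (forall p, f p != 0) ->
  class_C k f -> class_C k (fun p => (f p)^-1).
Proof.
move=> f0; elim: k => [|k IH] Ckf; have [cf df] := Ckf; split=> //;
  try by move=> p; apply: continuousV => //; exact: cf.
move=> mu; have [dfmu Cf] := df mu.
split=> [p|]; first exact: derivableV.
suff -> : 'D_(dir R mu) (fun p => (f p)^-1) =
    fun p => -1 * (((f p)^-1 * (f p)^-1) * 'D_(dir R mu) f p).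
  have CV := IH (class_CS Ckf).
  by apply: class_CM; [exact: class_C_cst|apply: class_CM => //; exact: class_CM].
apply/funext => p; rewrite deriveV // mulN1r scaleNr; congr (- _).
by rewrite -invfM -expr2.
Qed.

Lemma smooth_cst (a : R) : smooth (fun _ : spacetime R => a).
Proof. by move=> k; exact: class_C_cst. Qed.

Lemma smoothD f g : smooth f -> smooth g -> smooth (fun p => f p + g p).
Proof. by move=> sf sg k; exact: class_CD. Qed.

Lemma smoothM f g : smooth f -> smooth g -> smooth (fun p => f p * g p).
Proof. by move=> sf sg k; exact: class_CM. Qed.

Lemma smoothN f : smooth f -> smooth (fun p => - f p).
Proof.
move=> sf; have -> : (fun p => - f p) = (fun p => -1 * f p).
  by apply/funext => p; rewrite mulN1r.
by apply: smoothM => //; exact: smooth_cst.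
Qed.

Lemma smoothV f : (forall p, f p != 0) -> smooth f -> smooth (fun p => (f p)^-1).
Proof. by move=> f0 sf k; exact: class_CV. Qed.

Lemma smooth_derivable f mu p : smooth f -> derivable f p (dir R mu).
Proof. by move=> /(_ 1%N)[_ /(_ mu)[]]. Qed.

Lemma smooth_derive f mu : smooth f -> smooth ('D_(dir R mu) f).
Proof. by move=> sf k; have [_ /(_ mu)[]] := sf k.+1. Qed.

Lemma is_derive_line f (p v : spacetime R) (s : R) :
  derivable f (s *: v + p) v ->
  is_derive s 1 (fun h : R => f (h *: v + p)) ('D_v f (s *: v + p)).
Proof.
move=> df.
have E : (fun h => h^-1 *: ((fun h : R => f (h *: v + p)) (h *: 1 + s)
                      - f (s *: v + p))) =
         (fun h => h^-1 *: (f (h *: v + (s *: v + p)) - f (s *: v + p))).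
  by apply/funext => h; rewrite [h *: 1]mulr1 scalerDl addrA.
by apply: DeriveDef; rewrite /derivable /derive /= E.
Qed.

(** The mean value theorem for the restriction of [f] to the line through [p], on [[0, h]] or
    [[h, 0]] according to the sign of [h]. *)
Lemma mvt_line f (p v : spacetime R) (h : R) :
  (forall q, derivable f q v) ->
  exists2 s : R, `|s| <= `|h| & f (h *: v + p) - f p = 'D_v f (s *: v + p) * h.
Proof.
move=> df; pose g (s : R) := f (s *: v + p).
have dg (s : R) : is_derive s 1 g ('D_v f (s *: v + p)) by exact: is_derive_line.
have cg a b : {within `[a, b], continuous g}.
  apply: continuous_subspaceT => s; apply: differentiable_continuous.
  by apply/derivable1_diffP; have [] := dg s.
have g0 : g 0 = f p by rewrite /g scale0r add0r.
have [h0|h0] := leP 0 h.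
  have [s sh E] := MVT_segment h0 (fun s _ => dg s) (@cg 0 h).
  exists s; last by rewrite -g0 -[f (h *: v + p)]/(g h) E subr0.
  by move: sh; rewrite in_itv /= => /andP[s0 sh]; rewrite !ger0_norm.
have [s sh E] := MVT_segment (ltW h0) (fun s _ => dg s) (@cg h 0).
exists s; first by move: sh; rewrite in_itv /= => /andP[s0 sh];
  rewrite !ler0_norm ?(ltW h0) // lerN2.
by rewrite -g0 -[f (h *: v + p)]/(g h) -opprB E sub0r mulrN opprK.
Qed.

Lemma derive_shift_add f (a p v : spacetime R) :
  derivable f (a + p) v -> is_derive p v (fun q => f (a + q)) ('D_v f (a + p)).
Proof.
move=> df.
have E : (fun h => h^-1 *: (f (a + (h *: v + p)) - f (a + p))) =
         (fun h => h^-1 *: (f (h *: v + (a + p)) - f (a + p))).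
  by apply/funext => h; rewrite addrCA.
by apply: DeriveDef; rewrite /derivable /derive /= E.
Qed.

(* The second difference [f(p+hv+hw) - f(p+hv) - f(p+hw) + f p] divided by
   [h^2] is a value of each mixed derivative near [p]. *)
Lemma schwarz_smooth f (mu nu : 'I_3) p : smooth f ->
  'D_(dir R mu) ('D_(dir R nu) f) p = 'D_(dir R nu) ('D_(dir R mu) f) p.
Proof.
move=> sf.
have mixed (al be : 'I_3) (e : R) : 0 < e -> \forall h \near (0 : R), h != 0 ->
    `|'D_(dir R al) ('D_(dir R be) f) p -
      (f (h *: dir R al + (h *: dir R be + p)) - f (h *: dir R be + p) -
      (f (h *: dir R al + p) - f p)) / h ^+ 2| < e.
  move=> e0.
  have sD := smooth_derive al (smooth_derive be sf).
  have cD : 'D_(dir R al) ('D_(dir R be) f) @ p -->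
            'D_(dir R al) ('D_(dir R be) f) p.
    exact: (class_C_continuous (sD 0%N)).
  move/cvgrPdist_lt: cD => /(_ e e0)/nbhs_ballP[d /= d0 dP].
  exists (d / 2) => /=; first by rewrite divr_gt0.
  move=> h /=; rewrite sub0r normrN => hd h0.
  (* The second difference is the increment of [F] along [be]; a first mean value turns it into an
     increment of the [be]-derivative along [al], a second one into a value of the mixed
     derivative. *)
  pose F q := f (h *: dir R al + q) - f q.
  have dF q : is_derive q (dir R be) F ('D_(dir R be) f (h *: dir R al + q)
                                       - 'D_(dir R be) f q).
    apply: is_deriveB; last by apply/derivableP; exact: smooth_derivable.
    exact/derive_shift_add/smooth_derivable.
  have [s sh] := @mvt_line F p (dir R be) h (fun q => @ex_derive _ _ _ _ _ _ _ (dF q)).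
  rewrite (@derive_val _ _ _ _ _ _ _ (dF _)).
  have [s' sh' ->] := @mvt_line ('D_(dir R be) f) (s *: dir R be + p) (dir R al) h
    (fun q => @smooth_derivable _ al q (smooth_derive be sf)).
  rewrite /F => ->; rewrite -mulrA -expr2 mulfK ?expf_neq0 //.
  apply: dP; split=> // i j; rewrite -ball_normE /= !mxE.
  have del (mu' : 'I_3) : `|(((i == 0) && (j == mu'))%:R : R)| <= 1.
    by case: (_ && _); rewrite ?normr1 ?normr0.
  set a := ((i == 0) && (j == al))%:R; set b := ((i == 0) && (j == be))%:R.
  have -> : p i j - (s' * a + (s * b + p i j)) = - (s' * a + s * b) by ring.
  rewrite normrN; apply: le_lt_trans (ler_normD _ _) _.
  (* The two offsets [s] and [s'] are bounded by [|h| < d / 2], so the evaluation point stays within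
     [d] of [p]. *)
  rewrite !normrM (splitr d); apply: ltr_leD.
    apply: le_lt_trans hd; rewrite -[leRHS]mulr1; apply: ler_pM => //; exact: del.
  apply: le_trans (ltW hd); rewrite -[leRHS]mulr1; apply: ler_pM => //; exact: del.
have close (a b c e : R) : `|a - c| < e / 2 -> `|b - c| < e / 2 -> `|a - b| <= e.
  move=> ac bc; have -> : a - b = (a - c) - (b - c) by ring.
  apply: le_trans (ler_normB _ _) _; rewrite [leRHS]splitr.
  by apply: lerD; exact: ltW.
apply/eqP; rewrite -subr_eq0 -normr_eq0 eq_le normr_ge0 andbT.
apply/ler_addgt0Pr => e e0; rewrite add0r.
have e2 : 0 < e / 2 by rewrite divr_gt0.
have [d /= d0 dP] := filterI (mixed mu nu _ e2) (mixed nu mu _ e2).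
(* A single nonzero increment [d / 2] serves both orders: exchanging [mu] and [nu] only permutes the
   terms of the second difference. *)
have d2 : 0 < d / 2 by rewrite divr_gt0.
have [] := dP (d / 2); rewrite /= ?sub0r ?normrN ?(gtr0_norm d2) //.
  by rewrite ltr_pdivrMr // ltr_pMr // ltr1n.
move=> /(_ (lt0r_neq0 d2)) + /(_ (lt0r_neq0 d2)).
move: (d / 2) => h.
rewrite [h *: dir R nu + (_ + _)]addrCA.
set X := f _; set Y := f _; set Z := f _; set W := f p.
have -> : X - Z - (Y - W) = X - Y - (Z - W) by ring.
exact: close.
Qed.

End SmoothFunctions.

(** * Derivatives of complex and matrix valued functions *)

Section ComplexDerivatives.
Variable R : realType.
Local Notation C := (R[i]).
Implicit Types (f g : spacetime R -> C) (p : spacetime R) (mu : 'I_3).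

Lemma Re_mulc (x y : C) :
  complex.Re (x * y) = complex.Re x * complex.Re y - complex.Im x * complex.Im y.
Proof. by case: x y => [a b] [c d]. Qed.

Lemma Im_mulc (x y : C) :
  complex.Im (x * y) = complex.Re x * complex.Im y + complex.Im x * complex.Re y.
Proof. by case: x y => [a b] [c d]. Qed.

Lemma Re_addc (x y : C) : complex.Re (x + y) = complex.Re x + complex.Re y.
Proof. by case: x y => [a b] [c d]. Qed.

Lemma Im_addc (x y : C) : complex.Im (x + y) = complex.Im x + complex.Im y.
Proof. by case: x y => [a b] [c d]. Qed.

Lemma Re_conjc (x : C) : complex.Re x^* = complex.Re x.
Proof. by case: x. Qed.

Lemma Im_conjc (x : C) : complex.Im x^* = - complex.Im x.
Proof. by case: x. Qed.

Lemma complexP (x y : C) :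
  complex.Re x = complex.Re y -> complex.Im x = complex.Im y -> x = y.
Proof. by case: x y => [a b] [c d] /= -> ->. Qed.

(** Existence and value are recorded together, so that the rules of calculus compose without
    separate differentiability conditions. *)
Definition is_cderive mu f p (d : C) : Prop :=
  is_derive p (dir R mu) (fun q => complex.Re (f q)) (complex.Re d) /\
  is_derive p (dir R mu) (fun q => complex.Im (f q)) (complex.Im d).

Lemma is_cderive_cst mu (a : C) p : is_cderive mu (fun=> a) p 0.
Proof. by split; exact: is_derive_cst. Qed.

Lemma is_cderiveD mu f g p df dg : is_cderive mu f p df -> is_cderive mu g p dg ->
  is_cderive mu (fun q => f q + g q) p (df + dg).
Proof.
move=> [rf jf] [rg jg]; split; rewrite ?Re_addc ?Im_addc.
- have -> : (fun q => complex.Re (f q + g q)) =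
            (fun q => complex.Re (f q)) + (fun q => complex.Re (g q)).
    by apply/funext => q; rewrite Re_addc.
  exact: is_deriveD.
- have -> : (fun q => complex.Im (f q + g q)) =
            (fun q => complex.Im (f q)) + (fun q => complex.Im (g q)).
    by apply/funext => q; rewrite Im_addc.
  exact: is_deriveD.
Qed.

Lemma is_cderiveM mu f g p df dg : is_cderive mu f p df -> is_cderive mu g p dg ->
  is_cderive mu (fun q => f q * g q) p (df * g p + f p * dg).
Proof.
move=> [rf jf] [rg jg]; split; rewrite ?Re_addc ?Im_addc ?Re_mulc ?Im_mulc.
- have -> : (fun q => complex.Re (f q * g q)) =
       (fun q => complex.Re (f q)) * (fun q => complex.Re (g q)) -
       (fun q => complex.Im (f q)) * (fun q => complex.Im (g q)).
    by apply/funext => q; rewrite Re_mulc.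
  apply: is_derive_eq (is_deriveB (is_deriveM rf rg) (is_deriveM jf jg)) _.
  by rewrite /GRing.scale /=; ring.
- have -> : (fun q => complex.Im (f q * g q)) =
       (fun q => complex.Re (f q)) * (fun q => complex.Im (g q)) +
       (fun q => complex.Im (f q)) * (fun q => complex.Re (g q)).
    by apply/funext => q; rewrite Im_mulc.
  apply: is_derive_eq (is_deriveD (is_deriveM rf jg) (is_deriveM jf rg)) _.
  by rewrite /GRing.scale /=; ring.
Qed.

Lemma is_cderive_conj mu f p df : is_cderive mu f p df ->
  is_cderive mu (fun q => (f q)^*) p df^*.
Proof.
move=> [rf jf]; split; rewrite ?Re_conjc ?Im_conjc.
- suff -> : (fun q => complex.Re (f q)^*) = (fun q => complex.Re (f q)) by [].
  by apply/funext => q; rewrite Re_conjc.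
- have -> : (fun q => complex.Im (f q)^*) = - (fun q => complex.Im (f q)).
    by apply/funext => q; rewrite Im_conjc.
  exact: is_deriveN.
Qed.

Lemma is_cderive_sum mu (I : Type) (r : seq I) (F : I -> spacetime R -> C)
    (D : I -> C) p : (forall i, is_cderive mu (F i) p (D i)) ->
  is_cderive mu (fun q => \sum_(i <- r) F i q) p (\sum_(i <- r) D i).
Proof.
move=> FD; elim: r => [|i r IH].
  have -> : (fun q => \sum_(i <- [::]) F i q) = fun=> 0.
    by apply/funext => q; rewrite big_nil.
  by rewrite big_nil; exact: is_cderive_cst.
have -> : (fun q => \sum_(j <- i :: r) F j q) =
          fun q => F i q + \sum_(j <- r) F j q.
  by apply/funext => q; rewrite big_cons.
by rewrite big_cons; exact: is_cderiveD.
Qed.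

Lemma near_eq_is_cderive mu f g p d : (\forall q \near p, f q = g q) ->
  is_cderive mu f p d -> is_cderive mu g p d.
Proof.
move=> fg [rf jf]; split.
- by apply: near_eq_is_derive rf; apply: filterS fg => q ->.
- by apply: near_eq_is_derive jf; apply: filterS fg => q ->.
Qed.

Definition csmooth f : Prop :=
  smooth (fun p => complex.Re (f p)) /\ smooth (fun p => complex.Im (f p)).

Lemma csmooth_cst (a : C) : csmooth (fun=> a).
Proof. by split; exact: smooth_cst. Qed.

Lemma csmoothD f g : csmooth f -> csmooth g -> csmooth (fun p => f p + g p).
Proof.
move=> [rf jf] [rg jg]; split.
- under eq_fun do rewrite Re_addc; exact: smoothD.
- under eq_fun do rewrite Im_addc; exact: smoothD.
Qed.

Lemma csmoothM f g : csmooth f -> csmooth g -> csmooth (fun p => f p * g p).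
Proof.
move=> [rf jf] [rg jg]; split.
- under eq_fun do rewrite Re_mulc.
  by apply: smoothD; [|apply: smoothN]; exact: smoothM.
- under eq_fun do rewrite Im_mulc.
  by apply: smoothD; exact: smoothM.
Qed.

Lemma csmooth_conj f : csmooth f -> csmooth (fun p => (f p)^*).
Proof.
move=> [rf jf]; split.
- by under eq_fun do rewrite Re_conjc.
- by under eq_fun do rewrite Im_conjc; exact: smoothN.
Qed.

(** The inverse is the conjugate divided by the squared modulus [N], a smooth real function without
    zeros. *)
Lemma csmoothV f : (forall p, f p != 0) -> csmooth f ->
  csmooth (fun p => (f p)^-1).
Proof.
move=> f0 [rf jf].
pose N p := complex.Re (f p) * complex.Re (f p) + complex.Im (f p) * complex.Im (f p).
have N0 p : N p != 0.
  rewrite /N; move: (f0 p); case: (f p) => a b /=; apply: contraNneq => ab0.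
  move/eqP: ab0; rewrite -!expr2 paddr_eq0 ?sqr_ge0 // !sqrf_eq0.
  by case/andP => /eqP-> /eqP->.
have sN : smooth N by apply: smoothD; exact: smoothM.
have sV := smoothV N0 sN.
split.
- have -> : (fun p => complex.Re (f p)^-1) = fun p => complex.Re (f p) * (N p)^-1.
    by apply/funext => p; rewrite /N; case: (f p) => a b /=; rewrite !expr2.
  exact: smoothM.
- have -> : (fun p => complex.Im (f p)^-1) =
            fun p => (- complex.Im (f p)) * (N p)^-1.
    by apply/funext => p; rewrite /N; case: (f p) => a b /=; rewrite !expr2 mulNr.
  by apply: smoothM => //; exact: smoothN.
Qed.

Lemma csmooth_sum (I : Type) (r : seq I) (F : I -> spacetime R -> C) :
  (forall i, csmooth (F i)) -> csmooth (fun q => \sum_(i <- r) F i q).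
Proof.
move=> sF; elim: r => [|i r IH].
  by under eq_fun do rewrite big_nil; exact: csmooth_cst.
by under eq_fun do rewrite big_cons; exact: csmoothD.
Qed.

Lemma csmooth_prod (I : Type) (r : seq I) (F : I -> spacetime R -> C) :
  (forall i, csmooth (F i)) -> csmooth (fun q => \prod_(i <- r) F i q).
Proof.
move=> sF; elim: r => [|i r IH].
  by under eq_fun do rewrite big_nil; exact: csmooth_cst.
by under eq_fun do rewrite big_cons; exact: csmoothM.
Qed.

End ComplexDerivatives.

(** * Entrywise derivatives and smoothness of matrix valued maps *)

Section MatrixDerivatives.
Variable R : realType.
Local Notation C := (R[i]).
Implicit Types (p : spacetime R) (mu : 'I_3).

Definition is_mderive m n mu (F : spacetime R -> 'M[C]_(m, n)) p
    (D : 'M[C]_(m, n)) : Prop :=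
  forall a b, is_cderive mu (fun q => F q a b) p (D a b).

Lemma is_mderive_pderiv m n mu (F : spacetime R -> 'M[C]_(m, n)) p D :
  is_mderive mu F p D -> pderiv mu F p = D.
Proof.
move=> FD; apply/matrixP => a b; rewrite mxE.
have [rF jF] := FD a b; apply: complexP => /=; exact: derive_val.
Qed.

Lemma smooth_is_mderive m n mu (F : spacetime R -> 'M[C]_(m, n)) p :
  smooth_mx F -> is_mderive mu F p (pderiv mu F p).
Proof.
move=> sF a b; have [rF jF] := sF a b; rewrite mxE.
by split; apply/derivableP; exact: smooth_derivable.
Qed.

Lemma is_mderive_cst m n mu (A : 'M[C]_(m, n)) p : is_mderive mu (fun=> A) p 0.
Proof. by move=> a b; rewrite mxE; exact: is_cderive_cst. Qed.

Lemma is_mderiveD m n mu (F G : spacetime R -> 'M[C]_(m, n)) p DF DG :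
  is_mderive mu F p DF -> is_mderive mu G p DG ->
  is_mderive mu (fun q => F q + G q) p (DF + DG).
Proof.
move=> dF dG a b; rewrite mxE; under eq_fun do rewrite mxE.
exact: is_cderiveD.
Qed.

Lemma is_mderiveZ m n mu (s : C) (F : spacetime R -> 'M[C]_(m, n)) p DF :
  is_mderive mu F p DF -> is_mderive mu (fun q => s *: F q) p (s *: DF).
Proof.
move=> dF a b; rewrite mxE; under eq_fun do rewrite mxE.
rewrite -[s * _]add0r -[0](mul0r (F p a b)).
by apply: is_cderiveM => //; exact: is_cderive_cst.
Qed.

Lemma is_mderiveM m n k mu (F : spacetime R -> 'M[C]_(m, n))
    (G : spacetime R -> 'M[C]_(n, k)) p DF DG :
  is_mderive mu F p DF -> is_mderive mu G p DG ->
  is_mderive mu (fun q => F q *m G q) p (DF *m G p + F p *m DG).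
Proof.
move=> dF dG a b; rewrite !mxE -big_split /=; under eq_fun do rewrite mxE.
by apply: is_cderive_sum => j; exact: is_cderiveM.
Qed.

Lemma is_mderive_trmxC m n mu (F : spacetime R -> 'M[C]_(m, n)) p DF :
  is_mderive mu F p DF -> is_mderive mu (fun q => (F q)^t*) p (DF^t*).
Proof.
move=> dF a b; rewrite !mxE; under eq_fun do rewrite !mxE.
exact: is_cderive_conj.
Qed.

Lemma near_eq_is_mderive m n mu (F G : spacetime R -> 'M[C]_(m, n)) p D :
  (\forall q \near p, F q = G q) -> is_mderive mu F p D -> is_mderive mu G p D.
Proof.
move=> FG dF a b; apply: near_eq_is_cderive (dF a b).
by apply: filterS FG => q ->.
Qed.

Lemma smooth_mx_cst m n (A : 'M[C]_(m, n)) : smooth_mx (fun _ : spacetime R => A).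
Proof. by move=> a b; exact: csmooth_cst. Qed.

Lemma smooth_mxD m n (F G : spacetime R -> 'M[C]_(m, n)) :
  smooth_mx F -> smooth_mx G -> smooth_mx (fun q => F q + G q).
Proof.
move=> sF sG a b; rewrite -/(csmooth (fun p => (F p + G p) a b)).
under eq_fun do rewrite mxE; exact: csmoothD.
Qed.

Lemma smooth_mxZ m n (f : spacetime R -> C) (F : spacetime R -> 'M[C]_(m, n)) :
  csmooth f -> smooth_mx F -> smooth_mx (fun q => f q *: F q).
Proof.
move=> sf sF a b; rewrite -/(csmooth (fun p => (f p *: F p) a b)).
under eq_fun do rewrite mxE; exact: csmoothM.
Qed.

Lemma smooth_mxM m n k (F : spacetime R -> 'M[C]_(m, n))
    (G : spacetime R -> 'M[C]_(n, k)) :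
  smooth_mx F -> smooth_mx G -> smooth_mx (fun q => F q *m G q).
Proof.
move=> sF sG a b; rewrite -/(csmooth (fun p => (F p *m G p) a b)).
under eq_fun do rewrite mxE.
by apply: csmooth_sum => j; exact: csmoothM.
Qed.

Lemma smooth_mx_trmxC m n (F : spacetime R -> 'M[C]_(m, n)) :
  smooth_mx F -> smooth_mx (fun q => (F q)^t*).
Proof.
move=> sF a b; rewrite -/(csmooth (fun p => ((F p)^t*) a b)).
under eq_fun do rewrite !mxE; exact: csmooth_conj.
Qed.

Lemma csmooth_det n (F : spacetime R -> 'M[C]_n) :
  smooth_mx F -> csmooth (fun q => \det (F q)).
Proof.
move=> sF; apply: csmooth_sum => s; apply: csmoothM; first exact: csmooth_cst.
by apply: csmooth_prod => i; exact: sF.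
Qed.

(** Cramer's rule: the inverse is the adjugate over the determinant, both polynomial in the
    entries. *)
Lemma smooth_mx_inv n (F : spacetime R -> 'M[C]_n) :
  (forall q, F q \in unitmx) -> smooth_mx F -> smooth_mx (fun q => invmx (F q)).
Proof.
move=> uF sF.
have -> : (fun q => invmx (F q)) = fun q => (\det (F q))^-1 *: \adj (F q).
  by apply/funext => q; rewrite /invmx uF.
apply: smooth_mxZ.
  apply: csmoothV; last exact: csmooth_det.
  by move=> q; have := uF q; rewrite unitmxE unitfE.
move=> a b; rewrite -/(csmooth (fun p => (\adj (F p)) a b)).
under eq_fun do rewrite mxE /cofactor.
apply: csmoothM; first exact: csmooth_cst.
apply: csmooth_det => i j; rewrite -/(csmooth (fun p => (row' b (col' a (F p))) i j)).
by under eq_fun do rewrite !mxE; exact: sF.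
Qed.

Lemma smooth_mx_pderiv m n mu (F : spacetime R -> 'M[C]_(m, n)) :
  smooth_mx F -> smooth_mx (pderiv mu F).
Proof.
move=> sF a b; rewrite -/(csmooth (fun p => (pderiv mu F p) a b)).
under eq_fun do rewrite mxE.
by have [rF jF] := sF a b; split => /=; exact: smooth_derive.
Qed.

Lemma pderivC m n mu nu (F : spacetime R -> 'M[C]_(m, n)) p : smooth_mx F ->
  pderiv mu (pderiv nu F) p = pderiv nu (pderiv mu F) p.
Proof.
move=> sF; apply/matrixP => a b; rewrite [LHS]mxE [RHS]mxE.
have [rF jF] := sF a b.
have E be : (fun q => complex.Re (pderiv be F q a b)) =
               'D_(dir R be) (fun q => complex.Re (F q a b)) /\
               (fun q => complex.Im (pderiv be F q a b)) =
               'D_(dir R be) (fun q => complex.Im (F q a b)) :> (spacetime R -> R).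
  by split; apply/funext => q; rewrite mxE.
have [Er Ei] := E nu; have [Er' Ei'] := E mu.
have Dmu (G H : spacetime R -> R) al : G = H ->
    'D_(dir R al) G p = 'D_(dir R al) H p by move=> ->.
apply: complexP.
- exact: (etrans (Dmu _ _ mu Er) (etrans (schwarz_smooth mu nu p rF)
    (esym (Dmu _ _ nu Er')))).
- exact: (etrans (Dmu _ _ mu Ei) (etrans (schwarz_smooth mu nu p jF)
    (esym (Dmu _ _ nu Ei')))).
Qed.

End MatrixDerivatives.

(** * Hermitian projections *)

Section HermitianProjections.
Variables (K : numClosedFieldType) (n : nat).
Implicit Types (P Q g : 'M[K]_n) (a b : K).

Lemma trmxC_mul m k l (A : 'M[K]_(m, k)) (B : 'M[K]_(k, l)) :
  (A *m B)^t* = B^t* *m A^t*.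
Proof. by rewrite trmx_mul map_mxM. Qed.

Lemma trmxCD m k (A B : 'M[K]_(m, k)) : (A + B)^t* = A^t* + B^t*.
Proof. by apply/matrixP => i j; rewrite !mxE rmorphD. Qed.

Lemma trmxCN m k (A : 'M[K]_(m, k)) : (- A)^t* = - A^t*.
Proof. by apply/matrixP => i j; rewrite !mxE rmorphN. Qed.

Lemma trmxCZ m k a (A : 'M[K]_(m, k)) : (a *: A)^t* = a^* *: A^t*.
Proof. by apply/matrixP => i j; rewrite !mxE rmorphM. Qed.

Lemma trmxC1 : (1%:M : 'M[K]_n)^t* = 1%:M.
Proof. by rewrite trmx1 map_mx1. Qed.

Definition herm_proj P : Prop := P^t* = P /\ P *m P = P.

Lemma hproj_herm m (A : 'M[K]_(n, m)) : herm_proj (hproj A).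
Proof. by have [] := hprojP A. Qed.

Lemma mul_hproj m (A : 'M[K]_(n, m)) : hproj A *m A = A.
Proof.
apply: trmx_inj; rewrite trmx_mul trmxK proj_ortho_id //; exact: submx_refl.
Qed.

Lemma hproj_factor m (A : 'M[K]_(n, m)) : exists M, hproj A = A *m M.
Proof.
have [_ _ /andP[/submxP[D DE] _]] := hprojP A.
by exists D^T; apply: trmx_inj; rewrite DE trmx_mul trmxK.
Qed.

Lemma rank_hproj m (A : 'M[K]_(n, m)) : \rank (hproj A) = \rank A.
Proof.
by have [_ _ /eqmxP E] := hprojP A; rewrite -mxrank_tr E mxrank_tr.
Qed.

(** The hypotheses say that [P] and [Q = hproj A] have the same image, so [QP = P] and [PQ = Q]; the
    adjoint of the first relation is [PQ = P]. *)
Lemma hproj_unique m (A : 'M[K]_(n, m)) P (M : 'M[K]_(m, n)) :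
  herm_proj P -> P *m A = A -> P = A *m M -> hproj A = P.
Proof.
move=> [Ph PP] PA PE; have [Qh QQ] := hproj_herm A.
have [N QE] := hproj_factor A.
have QP : hproj A *m P = P by rewrite PE mulmxA mul_hproj.
have PQ : P *m hproj A = hproj A by rewrite QE mulmxA PA.
by rewrite -PQ -[RHS]Ph -[in RHS]QP trmxC_mul Ph Qh.
Qed.

Lemma hproj_id P : herm_proj P -> hproj P = P.
Proof. by move=> hP; apply: (@hproj_unique _ P P 1%:M); rewrite ?mulmx1 //; case: hP. Qed.

Lemma mulmx_trmxC_eq0 m k (A : 'M[K]_(m, k)) : A *m A^t* = 0 -> A = 0.
Proof.
move=> A0; apply/matrixP => i j; rewrite mxE.
have : (A *m A^t*) i i = 0 by rewrite A0 mxE.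
rewrite mxE => /eqP; rewrite psumr_eq0; last first.
  by move=> l _; rewrite !mxE mul_conjC_ge0.
by move=> /allP/(_ j (mem_index_enum _)); rewrite !mxE mul_conjC_eq0 => /eqP.
Qed.

(** The Gram operator of [g] on the image of [P], completed by the identity on the orthogonal
    complement: it is inverted without choosing a basis of the image. *)
Definition gram P g : 'M[K]_n := P *m g^t* *m g *m P + (1%:M - P).

Lemma gram_unit P g : herm_proj P -> g \in unitmx -> gram P g \in unitmx.
Proof.
move=> [Ph PP] ug; rewrite -row_free_unit -kermx_eq0; apply/eqP.
move: (kermx _) (mulmx_ker (gram P g)) => N NS.
(* For [N] in the left kernel, [X] times its adjoint is [N], [gram P g] and the adjoint of [N]
   multiplied together, hence zero. Both blocks of [X] then vanish, and with them [N P] and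
   [N (1 - P)]. *)
pose X := row_mx (N *m P *m g^t*) (N *m (1%:M - P)).
have /mulmx_trmxC_eq0 X0 : X *m X^t* = 0.
  rewrite tr_row_mx map_col_mx mul_row_col !trmxC_mul trmxCK.
  rewrite trmxCD trmxCN trmxC1 Ph !mulmxA.
  have C : (1%:M - P) *m (1%:M - P) = 1%:M - P.
    by rewrite mulmxBl mul1mx mulmxBr mulmx1 PP subrr subr0.
  rewrite -[N *m _ *m (1%:M - P)]mulmxA C.
  rewrite -mulmxDl; transitivity (N *m gram P g *m N^t*); last by rewrite NS mul0mx.
  by rewrite /gram [in RHS]mulmxDr !mulmxA.
have := X0; rewrite -[0](@row_mx0 _ _ n n) => /eq_row_mx[X1 X2].
have NP : N *m P = 0.
  have ug' : g^t* \in unitmx by rewrite map_unitmx unitmx_tr.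
  by rewrite -(mulmxK ug' (N *m P)) X1 mul0mx.
by rewrite -[N]mulmx1 -(subrK P 1%:M) mulmxDr X2 NP addr0.
Qed.

(* Unlike [proj_ortho], this expression is rational in [P], [g] and their
   conjugates, so that it depends smoothly on them. *)
Lemma hproj_gram P g : herm_proj P -> g \in unitmx ->
  hproj (g *m P) = g *m P *m invmx (gram P g) *m P *m g^t*.
Proof.
move=> hP ug; have [Ph PP] := hP; have uS := gram_unit hP ug; set S := gram P g.
have SP : S *m P = P *m g^t* *m g *m P.
  by rewrite /S /gram mulmxDl mulmxBl mul1mx PP subrr addr0 -!mulmxA PP.
have PS : P *m S = P *m g^t* *m g *m P.
  by rewrite /S /gram mulmxDr mulmxBr mulmx1 PP subrr addr0 !mulmxA PP.
have Sh : S^t* = S.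
  rewrite /S /gram trmxCD trmxCD trmxCN trmxC1 !trmxC_mul trmxCK Ph.
  by rewrite !mulmxA.
(* [S] commutes with [P], hence so does its inverse; this makes the candidate Hermitian and lets [S]
   cancel in its square. *)
have SVP : invmx S *m P = P *m invmx S.
  apply: (can_inj (mulKmx uS)); rewrite mulmxA mulmxV // mul1mx mulmxA SP -PS.
  by rewrite mulmxK.
have SVh : (invmx S)^t* = invmx S.
  by rewrite trmx_inv map_invmx Sh.
set M := invmx S *m P *m g^t*.
have E : g *m P *m invmx S *m P *m g^t* = g *m P *m M by rewrite /M !mulmxA.
apply: (@hproj_unique _ _ _ M) => //; last first.
  rewrite -!mulmxA; congr (g *m _); rewrite !mulmxA.
  have -> : P *m invmx S *m P *m g^t* *m g *m P =
            P *m invmx S *m (P *m g^t* *m g *m P) by rewrite !mulmxA.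
  by rewrite -SP mulmxA mulmxKV // PP.
split.
  by rewrite !trmxC_mul trmxCK Ph SVh !mulmxA.
rewrite -!mulmxA; congr (g *m _); rewrite !mulmxA; congr (_ *m _).
have -> : P *m invmx S *m P *m g^t* *m g *m P *m invmx S *m P =
          P *m invmx S *m (P *m g^t* *m g *m P) *m invmx S *m P.
  by rewrite !mulmxA.
by rewrite -PS !mulmxA mulmxK // -!mulmxA PP.
Qed.

(** Common form of [hfactor], with [a = (lambda - z) / (lambda - conj z)], and of the soliton map up
    to its scalar, with [a = conj z / z]. *)
Definition pencil P a : 'M[K]_n := (1%:M - P) + a *: P.

Lemma pencilM P a b : P *m P = P -> pencil P a *m pencil P b = pencil P (a * b).
Proof.
move=> PP; rewrite /pencil !(mulmxDl, mulmxDr, mulNmx, mulmxN, mulmx1, mul1mx).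
rewrite -!scalemxAl -!scalemxAr PP.
by apply/matrixP => i j; rewrite !mxE; ring.
Qed.

Lemma pencil1 P : pencil P 1 = 1%:M.
Proof. by rewrite /pencil scale1r subrK. Qed.

Lemma pencil_unit P a : P *m P = P -> a != 0 -> pencil P a \in unitmx.
Proof.
move=> PP a0; suff : pencil P a *m pencil P a^-1 = 1%:M by move/mulmx1_unit => [].
by rewrite pencilM // divff // pencil1.
Qed.

Lemma pencil_unitary P a : herm_proj P -> a * a^* = 1 -> pencil P a \is unitarymx.
Proof.
move=> [Ph PP] aa; apply/unitarymxP.
have -> : (pencil P a)^t* = pencil P a^*.
  by rewrite /pencil trmxCD trmxCD trmxCN trmxC1 trmxCZ Ph.
by rewrite pencilM // aa pencil1.
Qed.

(** Sylvester's identity, from two block triangular factorisations of one matrix. *)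
Lemma det_1pmul m (A : 'M[K]_(n, m)) (B : 'M[K]_(m, n)) :
  \det (1%:M + A *m B) = \det (1%:M + B *m A).
Proof.
have E1 : block_mx 1%:M (- A) B 1%:M =
  block_mx 1%:M 0 B 1%:M *m block_mx 1%:M (- A) 0 (1%:M + B *m A).
  by rewrite mulmx_block !mul1mx !mul0mx ?mulmx0 mulmx1 !addr0 mulmxN addrCA addNr addr0.
have E2 : block_mx 1%:M (- A) B 1%:M =
  block_mx 1%:M (- A) 0 1%:M *m block_mx (1%:M + A *m B) 0 B 1%:M.
  rewrite mulmx_block !mul1mx !mul0mx ?mulmx0 mulmx1 ?addr0 !add0r mulNmx.
  by rewrite addrK.
have := congr1 determinant E2; rewrite E1 !det_mulmx !det_lblock !det_ublock.
by rewrite !det1 !mul1r mulr1.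
Qed.

(** Factor [P] as [col_base P] times [row_base P]. Sylvester's identity reduces the determinant to
    that of the scalar matrix [a] of size the rank of [P]. *)
Lemma det_pencil P a : P *m P = P -> \det (pencil P a) = a ^+ \rank P.
Proof.
move=> PP; have PE := mulmx_base P.
(* Idempotency, with the injective left factor and the surjective right factor of [P] cancelled. *)
have BC : row_base P *m col_base P = 1%:M.
  apply: (row_free_inj (row_base_free P)); apply: (row_full_inj (col_base_full P)).
  have PP' : (col_base P *m row_base P) *m (col_base P *m row_base P) =
             col_base P *m row_base P by rewrite PE.
  by rewrite mul1mx -[RHS]PP' !mulmxA.
have -> : pencil P a = 1%:M + ((a - 1) *: col_base P) *m row_base P.
  by rewrite -scalemxAl PE /pencil scalerBl scale1r addrAC addrA.
rewrite det_1pmul -scalemxAr BC scalemx1 -raddfD /=.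
by rewrite addrC subrK det_scalar.
Qed.

End HermitianProjections.

(** * Holomorphic frames along spacetime *)

Section HolomorphicFrames.

Lemma near_ball_add (K : numFieldType) (w : K) (Q : K -> Prop) :
  (\forall x \near w, Q x) ->
  exists2 d : K, 0 < d & forall k, `|k| < d -> Q (k + w).
Proof.
move=> /nbhs_ballP[d /= d0 dQ]; exists d => // k kd; apply: dQ.
by rewrite -ball_normE /= opprD addrCA subrr addr0 normrN.
Qed.

(** A form of differentiability without division, valid also at [k = 0]: the increment of [w] along
    a spacetime direction may be zero. *)
Lemma derivable_approx (K : numFieldType) (f : K -> K) (w : K) :
  derivable f w 1 -> exists L : K, forall e : K, 0 < e ->
  exists2 d : K, 0 < d &
    forall k, `|k| < d -> `|f (k + w) - f w - k * L| <= e * `|k|.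
Proof.
move=> /cvg_ex[L /cvgrPdist_lt dL]; exists L => e e0.
have [d /= d0 dP] := dL e e0; exists d => // k kd.
have [->|k0] := eqVneq k 0.
  by rewrite add0r subrr sub0r mul0r oppr0 normr0 mulr0.
have := dP k; rewrite /= sub0r normrN => /(_ kd k0) /ltW.
rewrite [k *: 1]mulr1 -(ler_pM2r (_ : 0 < `|k|)) ?normr_gt0 // -normrM.
by rewrite mulrBl [_ *: _ * k]mulrAC mulVf // mul1r distrC [L * k]mulrC.
Qed.

Variable R : realType.
Local Notation C := (R[i]).
Implicit Types (z : C) (p v : spacetime R) (mu : 'I_3).

(** * The real valued modulus and the coordinate [w] as a real-linear map *)

Lemma norm_modulus (x : C) : `|x| = (modulus x)%:C%C.
Proof. by case: x. Qed.

Lemma modulus_ge0 (x : C) : 0 <= modulus x.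
Proof. by have := normr_ge0 x; rewrite norm_modulus lecR. Qed.

Lemma modulusM (x y : C) : modulus (x * y) = modulus x * modulus y.
Proof.
have := normrM x y; rewrite !norm_modulus -rmorphM; exact: complexI.
Qed.

Lemma modulus_real (h : R) : modulus h%:C%C = `|h|.
Proof. by rewrite /modulus /= expr0n /= addr0 sqrtr_sqr. Qed.

Lemma modulusD (x y : C) : modulus (x + y) <= modulus x + modulus y.
Proof. by have := ler_normD x y; rewrite !norm_modulus -rmorphD lecR. Qed.

Lemma normRe_modulus (x : C) : `|complex.Re x| <= modulus x.
Proof. by have := normc_ge_Re x; rewrite norm_modulus lecR. Qed.

Lemma normIm_modulus (x : C) : `|complex.Im x| <= modulus x.
Proof.
case: x => a b; rewrite /modulus /= -sqrtr_sqr ler_wsqrtr //.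
by rewrite lerDr sqr_ge0.
Qed.

Lemma gt0_complex (d : C) : 0 < d -> exists2 e : R, 0 < e & d = e%:C%C.
Proof. by case: d => a b; rewrite ltcE /= => /andP[/eqP-> a0]; exists a. Qed.

(** As [w] is linear on spacetime, this is also its partial derivative along [mu]. *)
Definition wdir z mu : C := wcoord z (dir R mu).

Lemma wcoordD z p v : wcoord z (p + v) = wcoord z p + wcoord z v.
Proof.
rewrite /wcoord !mxE; apply: complexP; rewrite !(Re_addc, Im_addc, Re_mulc, Im_mulc) /=.
all: by field.
Qed.

Lemma wcoordZ z (h : R) v : wcoord z (h *: v) = h%:C%C * wcoord z v.
Proof.
rewrite /wcoord !mxE; apply: complexP; rewrite !(Re_addc, Im_addc, Re_mulc, Im_mulc) /=.
all: by field.
Qed.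

Lemma wcoord_sum z v : wcoord z v = \sum_mu (v 0 mu)%:C%C * wdir z mu.
Proof.
rewrite [v in LHS]row_sum_delta.
by elim/big_ind2: _ => [|? ? ? ? <- <-|mu _]; rewrite ?wcoordD ?wcoordZ //
  -[X in wcoord _ X](scale0r v) wcoordZ mul0r.
Qed.

Lemma near_wcoord z p (Q : C -> Prop) :
  (exists2 d : C, 0 < d & forall k, `|k| < d -> Q (k + wcoord z p)) ->
  \forall q \near p, Q (wcoord z q).
Proof.
move=> [_ /gt0_complex[d d0 ->] dQ].
(* A Lipschitz constant for [w]; the added 1 makes it positive and the final inequality strict. *)
pose N := \sum_mu modulus (wdir z mu) + 1.
have N0 : 0 < N by rewrite ltr_wpDl // sumr_ge0 // => mu _; exact: modulus_ge0.
apply/nbhs_ballP; exists (d / N) => /=; first exact: divr_gt0.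
move=> q [_ pq]; have -> : q = (q - p) + p by rewrite subrK.
rewrite wcoordD; apply: dQ; rewrite norm_modulus ltcR wcoord_sum.
apply: (@le_lt_trans _ _ (\sum_mu d / N * modulus (wdir z mu))).
  apply: (@le_trans _ _ (\sum_mu modulus (((q - p) 0 mu)%:C%C * wdir z mu))).
    elim/big_ind2: _ => [|x1 x2 y1 y2 h1 h2|//].
      by rewrite /modulus normr0.
    exact: le_trans (modulusD _ _) (lerD h1 h2).
  apply: ler_sum => mu _; rewrite modulusM modulus_real ler_wpM2r ?modulus_ge0 //.
  by have := pq 0 mu; rewrite -ball_normE /= !mxE distrC => /ltW.
rewrite -mulr_sumr -mulrA gtr_pMr // mulrC ltr_pdivrMr // mul1r.
by rewrite /N ltrDl.
Qed.

(** Real and imaginary parts are real-linear and bounded by the modulus; [part] uses nothing else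
    and so treats both. *)
Lemma is_cderive_approx mu (f : spacetime R -> C) p (d : C) :
  (forall e : R, 0 < e -> exists2 r : R, 0 < r & forall h : R, `|h| < r ->
    modulus (f (h *: dir R mu + p) - f p - h%:C%C * d) <= e * `|h|) ->
  is_cderive mu f p d.
Proof.
move=> approx.
have part (g : C -> R) : (forall x y, g (x - y) = g x - g y) ->
    (forall (h : R) x, g (h%:C%C * x) = h * g x) ->
    (forall x, `|g x| <= modulus x) ->
    is_derive p (dir R mu) (fun q => g (f q)) (g d).
  move=> gB gZ gm.
  have cv : (fun h : R => h^-1 *: (g (f (h *: dir R mu + p)) - g (f p))) @ 0^'
            --> g d.
    apply/cvgrPdist_le => e e0; have [r r0 rP] := approx e e0.
    exists r => //= h /=; rewrite sub0r normrN => hr h0.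
    rewrite distrC -(ler_pM2r (_ : 0 < `|h|)) ?normr_gt0 // -normrM mulrBl.
    rewrite [_ *: _ * h]mulrAC mulVf // mul1r -gB mulrC -gZ -gB.
    exact: le_trans (gm _) (rP h hr).
  by apply: DeriveDef; [apply/cvg_ex; exists (g d)|exact: cvg_lim].
split; apply: part.
- by move=> [? ?] [? ?].
- by move=> h x; rewrite Re_mulc /= mul0r subr0.
- exact: normRe_modulus.
- by move=> [? ?] [? ?].
- by move=> h x; rewrite Im_mulc /= mul0r addr0.
- exact: normIm_modulus.
Qed.

(** The chain rule: a shift by [h] along [mu] moves [w] by exactly [h * wdir z mu]. *)
Lemma is_cderive_wcoord z p (f : C -> C) (L : C) :
  (forall e : C, 0 < e -> exists2 d : C, 0 < d & forall k, `|k| < d ->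
    `|f (k + wcoord z p) - f (wcoord z p) - k * L| <= e * `|k|) ->
  forall mu, is_cderive mu (fun q => f (wcoord z q)) p (wdir z mu * L).
Proof.
move=> fL mu; apply: is_cderive_approx => e e0.
set c := wdir z mu; pose N := modulus c + 1.
have N0 : 0 < N by rewrite ltr_wpDl // modulus_ge0.
have cN : modulus c < N by rewrite /N ltrDl.
have [|_ /gt0_complex[d d0 ->] dP] := fL (e / N)%:C%C.
  by rewrite ltcR divr_gt0.
exists (d / N); first exact: divr_gt0.
move=> h hd; rewrite wcoordD wcoordZ -/c.
have hcN : modulus (h%:C%C * c) <= `|h| * N.
  by rewrite modulusM modulus_real ler_wpM2l // ltW.
have := dP (h%:C%C * c); rewrite !norm_modulus -rmorphM lecR ltcR mulrA.
move=> H; apply: le_trans (H _) _.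
  by apply: le_lt_trans hcN _; rewrite -ltr_pdivlMr.
rewrite -mulrA ler_pM2l // mulrC ler_pdivrMr //.
Qed.

(** One matrix [dF] serves all directions, so any field annihilating [w] annihilates the frame. *)
Lemma holomorphic_near_frame n k (F : C -> 'M[C]_(n, k)) z p :
  holomorphic_near F (wcoord z p) ->
  exists dF : 'M[C]_(n, k), forall mu,
    is_mderive mu (fun q => F (wcoord z q)) p (wdir z mu *: dF).
Proof.
move=> hF.
have dF a b : exists L, forall mu,
    is_cderive mu (fun q => F (wcoord z q) a b) p (wdir z mu * L).
  have /derivable_approx[L HL] := nbhs_singleton hF a b.
  by exists L; exact: (@is_cderive_wcoord z p (fun w => F w a b) L HL).
exists (\matrix_(a, b) projT1 (choice (dF a)) b) => mu a b; rewrite !mxE.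
exact: (projT2 (choice (dF a)) b mu).
Qed.

Lemma soliton_herm_proj n k z (prj : spacetime R -> 'M[C]_n) p :
  extended_1soliton k z prj -> herm_proj (prj p) /\ \rank (prj p) = k.
Proof.
move=> [_ [V [P [_ _ /(_ (wcoord z p))[F [_ rF _ PF]] -> _]]]].
rewrite (nbhs_singleton PF) rank_hproj (nbhs_singleton rF); split=> //.
exact: hproj_herm.
Qed.

(* [cz] stands for a vector field annihilating [w], e.g. [z d_x - d_u]. *)
Lemma soliton_annihilated n k z (prj : spacetime R -> 'M[C]_n) (cz : 'I_3 -> C) p :
  extended_1soliton k z prj -> \sum_mu cz mu * wdir z mu = 0 ->
  (\sum_mu cz mu *: pderiv mu prj p) *m prj p = 0.
Proof.
move=> [_ [V [P [_ _ /(_ (wcoord z p))[F [hF _ _ PF]] prjE sprj]]]] cw.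
have [M PM] := hproj_factor (F (wcoord z p)).
have -> : prj p = F (wcoord z p) *m M.
  by rewrite prjE (nbhs_singleton PF) PM.
rewrite mulmxA; suff -> : (\sum_mu cz mu *: pderiv mu prj p) *m F (wcoord z p) = 0.
  by rewrite mul0mx.
have [dF HF] := holomorphic_near_frame hF.
have nearPF : \forall q \near p, prj q *m F (wcoord z q) = F (wcoord z q).
  have := @near_wcoord z p (fun w => P w = hproj (F w)) (near_ball_add PF).
  by apply: filterS => q E; rewrite prjE E mul_hproj.
(* Derivative of the identity [prj F = F]; the direction enters only through the scalar
   [wdir z mu]. *)
have E mu : pderiv mu prj p *m F (wcoord z p) = wdir z mu *: (dF - prj p *m dF).
  have dPF := near_eq_is_mderive nearPF
    (is_mderiveM (smooth_is_mderive mu p sprj) (HF mu)).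
  rewrite scalerBr; have := is_mderive_pderiv dPF.
  by rewrite (is_mderive_pderiv (HF mu)) => {1}->; rewrite -scalemxAr addrK.
rewrite mulmx_suml.
under eq_bigr do rewrite -scalemxAl E scalerA.
by rewrite -scaler_suml cw scale0r.
Qed.

End HolomorphicFrames.

(** * Lax pairs and Backlund transformations *)

Section LaxPairs.
Variables (R : realType) (n : nat).
Local Notation C := (R[i]).
Implicit Types (F G psi Phi g : spacetime R -> 'M[C]_n) (p : spacetime R).
Implicit Types (c : 'I_3 -> C).

(** The coefficients are complex, so that [z d_x - d_u] is itself one such field. *)
Definition vfield c F p : 'M[C]_n := \sum_mu c mu *: pderiv mu F p.

Lemma eq_vfield c F G p : F =1 G -> vfield c F p = vfield c G p.
Proof. by move=> /funext ->. Qed.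

Lemma vfieldM c F G p : smooth_mx F -> smooth_mx G ->
  vfield c (fun q => F q *m G q) p = vfield c F p *m G p + F p *m vfield c G p.
Proof.
move=> sF sG; rewrite /vfield mulmx_suml mulmx_sumr -big_split /=.
apply: eq_bigr => mu _; rewrite -scalemxAl -scalemxAr -scalerDr; congr (_ *: _).
by apply: is_mderive_pderiv; apply: is_mderiveM; exact: smooth_is_mderive.
Qed.

Lemma vfieldD c F G p : smooth_mx F -> smooth_mx G ->
  vfield c (fun q => F q + G q) p = vfield c F p + vfield c G p.
Proof.
move=> sF sG; rewrite /vfield -big_split /=.
apply: eq_bigr => mu _; rewrite -scalerDr; congr (_ *: _).
by apply: is_mderive_pderiv; apply: is_mderiveD; exact: smooth_is_mderive.
Qed.

Lemma vfieldZ c (a : C) F p : smooth_mx F ->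
  vfield c (fun q => a *: F q) p = a *: vfield c F p.
Proof.
move=> sF; rewrite /vfield scaler_sumr; apply: eq_bigr => mu _.
rewrite scalerA mulrC -scalerA; congr (_ *: _).
by apply: is_mderive_pderiv; apply: is_mderiveZ; exact: smooth_is_mderive.
Qed.

Lemma vfield_cst c (A : 'M[C]_n) p : vfield c (fun=> A) p = 0.
Proof.
rewrite /vfield big1 // => mu _.
by rewrite (is_mderive_pderiv (is_mderive_cst mu A p)) scaler0.
Qed.

Lemma vfield_trmxC c F p : smooth_mx F -> (forall mu, (c mu)^* = c mu) ->
  (vfield c F p)^t* = vfield c (fun q => (F q)^t*) p.
Proof.
move=> sF cr; rewrite /vfield raddf_sum /= raddf_sum /=; apply: eq_bigr => mu _.
rewrite trmxCZ cr; congr (_ *: _); apply/esym/is_mderive_pderiv.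
by apply: is_mderive_trmxC; exact: smooth_is_mderive.
Qed.

Lemma vfield_lin (a : C) c1 c2 F p :
  vfield (fun mu => a * c1 mu - c2 mu) F p = a *: vfield c1 F p - vfield c2 F p.
Proof.
rewrite /vfield scaler_sumr -sumrB; apply: eq_bigr => mu _.
by rewrite scalerBl scalerA.
Qed.

Lemma vfield_idem c F p : smooth_mx F -> (forall q, F q *m F q = F q) ->
  vfield c F p = vfield c F p *m F p + F p *m vfield c F p.
Proof. by move=> sF FF; rewrite -vfieldM //; exact: eq_vfield. Qed.

(** One equation of the Lax pair at one [lambda], cleared of the inverse of [psi]. The pairs of
    fields [(d_x, d_u)] and [(d_v, d_x)] give the two equations. *)
Definition lax c1 c2 (lambda : C) psi Phi : Prop := forall p,
  lambda *: vfield c1 psi p - vfield c2 psi p = vfield c1 Phi p *m psi p.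

Lemma smooth_hproj g (prj : spacetime R -> 'M[C]_n) :
  smooth_mx g -> smooth_mx prj -> (forall p, g p \in unitmx) ->
  (forall p, herm_proj (prj p)) -> smooth_mx (fun p => hproj (g p *m prj p)).
Proof.
move=> sg sP ug hP.
have -> : (fun p => hproj (g p *m prj p)) = (fun p =>
    g p *m prj p *m invmx (gram (prj p) (g p)) *m prj p *m (g p)^t*).
  by apply/funext => p; exact: hproj_gram.
have sgh := smooth_mx_trmxC sg.
have sPN : smooth_mx (fun p => 1%:M - prj p).
  apply: smooth_mxD; first exact: smooth_mx_cst.
  under eq_fun do rewrite -scaleN1r.
  by apply: smooth_mxZ => //; exact: csmooth_cst.
have sS : smooth_mx (fun p => gram (prj p) (g p)).
  by apply: smooth_mxD => //; do 3! (apply: smooth_mxM => //).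
have sSV : smooth_mx (fun p => invmx (gram (prj p) (g p))).
  by apply: smooth_mx_inv => // p; exact: gram_unit.
by do 4! (apply: smooth_mxM => //).
Qed.

Lemma smooth_pencil F (a : C) : smooth_mx F -> smooth_mx (fun p => pencil (F p) a).
Proof.
move=> sF.
have -> : (fun p => pencil (F p) a) = fun p => 1%:M + (a - 1) *: F p.
  apply/funext => p; rewrite /pencil scalerBl scale1r.
  by rewrite addrAC addrA.
apply: smooth_mxD; first exact: smooth_mx_cst.
by apply: smooth_mxZ => //; exact: csmooth_cst.
Qed.

Lemma vfield_pencil c F (a : C) p : smooth_mx F ->
  vfield c (fun q => pencil (F q) a) p = (a - 1) *: vfield c F p.
Proof.
move=> sF.
rewrite (@eq_vfield _ _ (fun q => 1%:M + (a - 1) *: F q)); last first.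
  by move=> q; rewrite /pencil scalerBl scale1r addrAC addrA.
rewrite vfieldD ?vfield_cst ?add0r ?vfieldZ //; first exact: smooth_mx_cst.
by apply: smooth_mxZ => //; exact: csmooth_cst.
Qed.

(* [t] is the value of the new projection and [t1], [t2] its derivatives. *)
Lemma backlund_identity (z : C) (t t1 t2 A : 'M[C]_n) :
  t^t* = t -> t1^t* = t1 -> t2^t* = t2 -> A^t* = - A ->
  t1 = t1 *m t + t *m t1 -> t2 = t2 *m t + t *m t2 ->
  (z *: t1 - t2 + t *m A - A) *m t = 0 ->
  z^* *: t1 + (z - z^*) *: (t1 *m t) - t2 + t *m A - A *m t = 0.
Proof.
move=> th t1h t2h Ah t1E t2E E1.
(* The adjoint of the hypothesis. In the sum of the two the terms [t A t] cancel, and [t t1], [t t2]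
   are eliminated by the derivative of [t t = t]. *)
have E2 : t *m (z^* *: t1 - t2 - A *m t + A) = 0.
  have := congr1 (fun M : 'M[C]_n => M^t*) E1.
  rewrite trmxC_mul !trmxCD !trmxCN trmxCZ trmxC_mul th t1h t2h Ah.
  by rewrite mulNmx opprK => ->; rewrite trmx0 map_mx0.
have : (z *: t1 - t2 + t *m A - A) *m t + t *m (z^* *: t1 - t2 - A *m t + A) = 0.
  by rewrite E1 E2 addr0.
rewrite !(mulmxDl, mulmxDr, mulNmx, mulmxN) -scalemxAl -scalemxAr mulmxA.
have -> : t *m t1 = t1 - t1 *m t by rewrite {2}t1E addrC addKr.
have -> : t *m t2 = t2 - t2 *m t by rewrite {2}t2E addrC addKr.
move=> <-.
move: (t1 *m t) (t2 *m t) (t *m A) (A *m t) (t *m A *m t) => B1 B2 B3 B4 B5.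
by apply/matrixP => i j; rewrite !mxE; ring.
Qed.

(** Since [s (lambda - conj z) = conj z - z], the two sides differ by [s] times the hypothesis,
    which does not involve [lambda]. *)
Lemma backlund_lax_identity (z lambda : C) (t t1 t2 A : 'M[C]_n) :
  lambda != z^* ->
  z^* *: t1 + (z - z^*) *: (t1 *m t) - t2 + t *m A - A *m t = 0 ->
  let s := (lambda - z) / (lambda - z^*) - 1 in
  lambda *: (s *: t1) - s *: t2 + (1%:M + s *: t) *m A =
  (A + (z^* - z) *: t1) *m (1%:M + s *: t).
Proof.
move=> lz E s.
have sE : z^* - z = s * (lambda - z^*).
  have lz0 : lambda - z^* != 0 by rewrite subr_eq0.
  by rewrite /s mulrBl divfK // mul1r; ring.
rewrite !(mulmxDl, mulmxDr, mul1mx, mulmx1) -!scalemxAl -!scalemxAr sE.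
have {}E := congr1 (fun M => s *: M) E; rewrite scaler0 in E.
have sE' : z - z^* = - (s * (lambda - z^*)) by rewrite -sE opprB.
rewrite sE' in E.
apply/eqP; rewrite -subr_eq0 -E; apply/eqP.
move: (t1 *m t) (t *m A) (A *m t) => B1 B3 B4.
by apply/matrixP => i j; rewrite !mxE; ring.
Qed.

(** Here [g] is the old solution at [z], from which the new projection is built, and [psi] the old
    solution at [lambda]. The new factor has [1/lambda] coefficient [conj z - z] times that
    projection, which is what [Phi] gains. *)
Lemma backlund_lax c1 c2 (z lambda : C) k prj g psi Phi :
  (forall mu, (c1 mu)^* = c1 mu) -> (forall mu, (c2 mu)^* = c2 mu) ->
  \sum_mu (z * c1 mu - c2 mu) * wdir z mu = 0 ->
  extended_1soliton k z prj -> smooth_mx prj ->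
  smooth_mx g -> (forall p, g p \in unitmx) -> smooth_mx psi ->
  smooth_mx Phi -> (forall p, (Phi p)^t* = - Phi p) ->
  lax c1 c2 z g Phi -> lax c1 c2 lambda psi Phi -> lambda != z^* ->
  lax c1 c2 lambda
    (fun p => pencil (hproj (g p *m prj p)) ((lambda - z) / (lambda - z^*)) *m psi p)
    (fun p => Phi p + (z^* - z) *: hproj (g p *m prj p)).
Proof.
move=> c1r c2r cw sol sP sg ug spsi sPhi Phih laxg laxpsi lz.
have hP p : herm_proj (prj p) by have [] := soliton_herm_proj p sol.
have sT := smooth_hproj sg sP ug hP.
set T := fun p => hproj (g p *m prj p) in sT *.
move=> p; rewrite -/(T p).
have Th q : (T q)^t* = T q by have [] := hproj_herm (g q *m prj q).
have TT q : T q *m T q = T q by have [] := hproj_herm (g q *m prj q).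
have [M TM] := hproj_factor (g p *m prj p).
set a := (lambda - z) / _; set A := vfield c1 Phi p.
have Ah : A^t* = - A.
  rewrite /A vfield_trmxC // (@eq_vfield _ _ (fun q => -1 *: Phi q)); last first.
    by move=> q; rewrite Phih scaleN1r.
  by rewrite vfieldZ // scaleN1r.
have VTh c : (forall mu, (c mu)^* = c mu) -> (vfield c T p)^t* = vfield c T p.
  by move=> cr; rewrite vfield_trmxC //; exact: eq_vfield.
(* The identity [T (g prj) = g prj] is differentiated along [z c1 - c2], where [g] obeys its Lax
   equation. Multiplication by [prj] on the right removes the derivatives of [prj], because the
   field annihilates [w]. *)
have E1 : (z *: vfield c1 T p - vfield c2 T p + T p *m A - A) *m T p = 0.
  pose cz mu := z * c1 mu - c2 mu.
  have PP : prj p *m prj p = prj p by have [] := hP p.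
  have dP : vfield cz prj p *m prj p = 0 by exact: soliton_annihilated sol cw.
  have dg : vfield cz g p = A *m g p by rewrite vfield_lin laxg.
  have sgP : smooth_mx (fun q => g q *m prj q) by exact: smooth_mxM.
  have E : vfield cz T p *m (g p *m prj p) + T p *m (A *m (g p *m prj p)) =
           A *m (g p *m prj p).
    have := @eq_vfield cz (fun q => T q *m (g q *m prj q))
      (fun q => g q *m prj q) p (fun q => mul_hproj _).
    have dgP := vfieldM cz p sg sP; rewrite dg in dgP.
    rewrite (vfieldM cz p sT sgP) dgP => /(congr1 (fun N => N *m prj p)) /=.
    by rewrite !(mulmxDl, mulmxDr) -!mulmxA dP !mulmx0 !addr0 PP.
  rewrite -vfield_lin -/cz.
  set X := _ - A; have -> : T p = g p *m prj p *m M := TM.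
  rewrite mulmxA; suff -> : X *m (g p *m prj p) = 0 by rewrite mul0mx.
  by rewrite /X mulmxBl mulmxDl -[T p *m A *m _]mulmxA E subrr.
have E3 := backlund_identity (Th p) (VTh _ c1r) (VTh _ c2r) Ah
  (vfield_idem c1 p sT TT) (vfield_idem c2 p sT TT) E1.
have := backlund_lax_identity lz E3; rewrite /= -/a => E4.
have sH := smooth_pencil a sT.
rewrite !vfieldM // !vfield_pencil //.
rewrite [vfield c1 (fun q => Phi q + _) p]vfieldD //; last first.
  by apply: smooth_mxZ => //; exact: csmooth_cst.
rewrite vfieldZ // -/A mulmxA.
have HE : pencil (T p) a = 1%:M + (a - 1) *: T p.
  by rewrite /pencil scalerBl scale1r addrAC addrA.
have Lpsi := laxpsi p; rewrite -/A in Lpsi.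
rewrite -/T -/(T p) HE.
move: E4 Lpsi; move: (1%:M + _) (vfield c1 T p) (vfield c2 T p) => H V1 V2 <- Lpsi.
rewrite [RHS]mulmxDl -[H *m A *m _]mulmxA -Lpsi mulmxBl mulmxBr scalerDr.
by rewrite -!scalemxAl -scalemxAr opprD addrACA.
Qed.

End LaxPairs.

(** * Ward maps *)

Section WardMaps.
Variables (R : realType) (n : nat).
Local Notation C := (R[i]).
Implicit Types (J Phi prj : spacetime R -> 'M[C]_n) (p : spacetime R).
Implicit Types (z lambda : C) (psi : spacetime R -> C -> 'M[C]_n).

Lemma sum_coords (V : nmodType) (f : 'I_3 -> V) :
  \sum_mu f mu = f ix + f iy + f it.
Proof.
rewrite !big_ord_recl big_ord0 addr0 addrA.
by congr (f _ + f _ + f _); apply: val_inj.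
Qed.

(** Since [t = u + v] and [y = u - v], the fields are [d_u = d_t + d_y] and [d_v = d_t - d_y]. *)
Definition dx (mu : 'I_3) : C := (mu == ix)%:R.
Definition du (mu : 'I_3) : C := (mu == it)%:R + (mu == iy)%:R.
Definition dv (mu : 'I_3) : C := (mu == it)%:R - (mu == iy)%:R.

Lemma vfield_dx J p : vfield dx J p = pderiv ix J p.
Proof. by rewrite /vfield sum_coords /dx /= scale1r !scale0r !addr0. Qed.

Lemma vfield_du J p : vfield du J p = pderiv it J p + pderiv iy J p.
Proof.
rewrite /vfield sum_coords /du /= !(addr0, add0r) !scale1r scale0r add0r.
exact: addrC.
Qed.

Lemma vfield_dv J p : vfield dv J p = pderiv it J p - pderiv iy J p.
Proof.
rewrite /vfield sum_coords /dv /= !(subr0, sub0r) scaleN1r scale1r scale0r add0r.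
exact: addrC.
Qed.

Lemma dx_real mu : (dx mu)^* = dx mu. Proof. by rewrite rmorph_nat. Qed.

Lemma du_real mu : (du mu)^* = du mu.
Proof. by rewrite rmorphD /= !rmorph_nat. Qed.

Lemma dv_real mu : (dv mu)^* = dv mu.
Proof. by rewrite rmorphB /= !rmorph_nat. Qed.

Lemma wdir_x z : wdir z ix = 1.
Proof.
rewrite /wdir /wcoord /dir !mxE /= addr0 subr0 mul0r !mulr0 !addr0.
by [].
Qed.

Lemma half_complex : (1 / 2 : R)%:C%C = 2^-1 :> C.
Proof. by rewrite mul1r fmorphV rmorph_nat. Qed.

Lemma wdir_y z : wdir z iy = (z - z^-1) / 2.
Proof.
rewrite /wdir /wcoord /dir !mxE /=.
have -> : (0 + 1) / 2 = 1 / 2 :> R by rewrite add0r.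
have -> : (0 - 1) / 2 = - (1 / 2) :> R by rewrite sub0r mulNr.
rewrite rmorphN half_complex rmorph0.
by move: z^-1 => y; field.
Qed.

Lemma wdir_t z : wdir z it = (z + z^-1) / 2.
Proof.
rewrite /wdir /wcoord /dir !mxE /= addr0 subr0 half_complex rmorph0.
by rewrite add0r mulrDl.
Qed.

(** In the coordinates [x, u, v] one has [w_x = 1], [w_u = z] and [w_v = 1/z]. *)
Lemma annihilator_xu z : \sum_mu (z * dx mu - du mu) * wdir z mu = 0.
Proof.
rewrite sum_coords wdir_x wdir_y wdir_t /dx /du /=.
by move: z^-1 => y; field.
Qed.

Lemma annihilator_vx z : z != 0 -> \sum_mu (z * dv mu - dx mu) * wdir z mu = 0.
Proof.
move=> z0; rewrite sum_coords wdir_x wdir_y wdir_t /dx /dv /=.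
by field.
Qed.

(* [Phi] is the [1/lambda] coefficient of [psi] at infinity; the two
   lambda-independent matrices of the extended solution are its derivatives. *)
Definition extended_solution (S : C -> Prop) psi Phi : Prop :=
  [/\ smooth_mx Phi, (forall p, (Phi p)^t* = - Phi p) &
   forall lambda, S lambda ->
    [/\ smooth_mx (psi^~ lambda), (forall p, psi p lambda \in unitmx),
        lax dx du lambda (psi^~ lambda) Phi &
        lax dv dx lambda (psi^~ lambda) Phi]].

Lemma extended_solution_sub (S S' : C -> Prop) psi Phi :
  (forall lambda, S' lambda -> S lambda) ->
  extended_solution S psi Phi -> extended_solution S' psi Phi.
Proof. by move=> SS [sPhi Phih H]; split=> // lambda /SS /H. Qed.

(** The trivial seed, admissible at every [lambda]; the first soliton arises from it by a Backlund
    transformation. *)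
Lemma extended_solution1 :
  extended_solution (fun=> True) (fun _ _ => 1%:M) (fun=> 0).
Proof.
split; [exact: smooth_mx_cst|by move=> p; rewrite trmx0 map_mx0 oppr0|].
move=> lambda _; split; [exact: smooth_mx_cst|by move=> p; exact: unitmx1| |];
  by move=> p; rewrite !vfield_cst scaler0 subr0 mul0mx.
Qed.

Lemma soliton_neq0 k z prj : extended_1soliton k z prj -> z != 0.
Proof. by move=> [z0 _]; apply: contraNneq z0 => ->. Qed.

Lemma soliton_smooth k z prj : extended_1soliton k z prj -> smooth_mx prj.
Proof. by move=> [_ [V [P []]]]. Qed.

(** The rank survives because [psi] is invertible at [z]; it determines the determinant of the new
    factor, hence the root [c]. *)
Lemma ptilde_facts (S : C -> Prop) k z prj psi Phi :
  extended_1soliton k z prj -> S z -> extended_solution S psi Phi ->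
  smooth_mx (ptilde z prj psi) /\
  forall p, herm_proj (ptilde z prj psi p) /\ \rank (ptilde z prj psi p) = k.
Proof.
move=> sol Sz [_ _ /(_ z Sz)[sg ug _ _]]; split.
  apply: (smooth_hproj sg (soliton_smooth sol) ug) => p.
  by have [] := soliton_herm_proj p sol.
move=> p; split; first exact: hproj_herm.
rewrite /ptilde rank_hproj -mxrank_tr trmx_mul mxrankMfree; last first.
  by rewrite row_free_unit unitmx_tr.
by rewrite mxrank_tr; have [] := soliton_herm_proj p sol.
Qed.

(** The new factor is degenerate at [lambda = z] and has a pole at the conjugate of [z], so these
    two values leave the admissible set. *)
Lemma backlund_extended_solution (S : C -> Prop) k z prj psi Phi :
  extended_1soliton k z prj -> S z -> extended_solution S psi Phi ->
  extended_solution (fun lambda => [/\ S lambda, lambda <> z & lambda <> z^*])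
    (backlund_ext z prj psi)
    (fun p => Phi p + (z^* - z) *: ptilde z prj psi p).
Proof.
move=> sol Sz ext; have [sT hT] := ptilde_facts sol Sz ext.
have [sPhi Phih H] := ext; have [sg ug laxg1 laxg2] := H z Sz.
have sP := soliton_smooth sol; have z0 := soliton_neq0 sol.
split.
- by apply: smooth_mxD => //; apply: smooth_mxZ => //; exact: csmooth_cst.
- move=> p; have [[Th _] _] := hT p.
  rewrite trmxCD trmxCZ Phih Th rmorphB /= conjCK opprD -scaleNr opprB.
  by [].
- move=> lambda [Sl /eqP lz /eqP lzb]; have [spsi upsi lax1 lax2] := H lambda Sl.
  split.
  + by apply: smooth_mxM => //; exact: smooth_pencil.
  + move=> p; rewrite /backlund_ext unitmx_mul upsi andbT.
    have [[_ TT] _] := hT p; apply: pencil_unit => //.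
    by rewrite mulf_neq0 ?invr_eq0 ?subr_eq0.
  + apply: (backlund_lax dx_real du_real (annihilator_xu z) sol sP sg ug spsi
      sPhi Phih laxg1 lax1 lzb).
  + apply: (backlund_lax dv_real dx_real (annihilator_vx z0) sol sP sg ug spsi
      sPhi Phih laxg2 lax2 lzb).
Qed.

(** * The Ward equation from the Lax pair at [lambda = 0] *)

Lemma logderiv_smooth mu J : smooth_mx J -> (forall p, J p \in unitmx) ->
  smooth_mx (logderiv mu J).
Proof.
move=> sJ uJ; apply: smooth_mxM; first exact: smooth_mx_inv.
exact: smooth_mx_pderiv.
Qed.

Lemma mul_logderiv mu J p : J p \in unitmx ->
  J p *m logderiv mu J p = pderiv mu J p.
Proof. by move=> uJ; rewrite /logderiv mulKVmx. Qed.

(** Zero curvature of the pure gauge [J^-1 dJ]: the two orders of second derivatives of [J] are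
    compared. *)
Lemma logderiv_flat mu nu J p : smooth_mx J -> (forall p, J p \in unitmx) ->
  pderiv mu (logderiv nu J) p - pderiv nu (logderiv mu J) p =
  logderiv nu J p *m logderiv mu J p - logderiv mu J p *m logderiv nu J p.
Proof.
move=> sJ uJ.
have D al be : pderiv al (pderiv be J) p =
    J p *m (logderiv al J p *m logderiv be J p + pderiv al (logderiv be J) p).
  have -> : pderiv be J = fun q => J q *m logderiv be J q.
    by apply/funext => q; rewrite mul_logderiv.
  rewrite (is_mderive_pderiv (is_mderiveM (smooth_is_mderive al p sJ)
    (smooth_is_mderive al p (logderiv_smooth be sJ uJ)))).
  by rewrite mulmxDr mulmxA mul_logderiv.
have := pderivC mu nu p sJ; rewrite !D => /(can_inj (mulKmx (uJ p))) E.
apply/eqP; rewrite subr_eq addrAC eq_sym subr_eq; apply/eqP.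
by rewrite -E addrC.
Qed.

Lemma lax0_derivative c1 c2 J (psi0 : spacetime R -> 'M[C]_n) Phi (c0 : C) p :
  smooth_mx J -> smooth_mx psi0 -> (forall p, psi0 p \in unitmx) ->
  (forall p, J p *m psi0 p = c0%:M) -> lax c1 c2 0 psi0 Phi ->
  vfield c2 J p = J p *m vfield c1 Phi p.
Proof.
move=> sJ spsi upsi Jpsi /(_ p); rewrite scale0r sub0r => L.
have := @eq_vfield _ _ c2 _ _ p Jpsi; rewrite vfieldM // vfield_cst.
have -> : vfield c2 psi0 p = - (vfield c1 Phi p *m psi0 p) by rewrite -L opprK.
rewrite mulmxN mulmxA => /subr0_eq E.
by rewrite -[LHS](mulmxK (upsi p)) E mulmxK.
Qed.

Lemma ward_equation_lax J (psi0 : spacetime R -> 'M[C]_n) Phi (c0 : C) :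
  smooth_mx J -> (forall p, J p \in unitmx) ->
  smooth_mx psi0 -> (forall p, psi0 p \in unitmx) -> smooth_mx Phi ->
  (forall p, J p *m psi0 p = c0%:M) ->
  lax dx du 0 psi0 Phi -> lax dv dx 0 psi0 Phi -> ward_equation J.
Proof.
move=> sJ uJ spsi upsi sPhi Jpsi lax1 lax2 p.
have atE : logderiv it J = fun q => pderiv ix Phi q - logderiv iy J q.
  apply/funext => q; have := lax0_derivative q sJ spsi upsi Jpsi lax1.
  rewrite vfield_du vfield_dx => E; apply: (can_inj (mulKmx (uJ q))).
  move: (mul_logderiv it (uJ q)) (mul_logderiv iy (uJ q)) E.
  move: (logderiv it J q) (logderiv iy J q) => at_ ay <- <-.
  by rewrite mulmxBr => <-; rewrite addrK.
have axE : logderiv ix J = fun q => pderiv it Phi q - pderiv iy Phi q.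
  apply/funext => q; have := lax0_derivative q sJ spsi upsi Jpsi lax2.
  rewrite vfield_dv vfield_dx => E; apply: (can_inj (mulKmx (uJ q))).
  by rewrite mul_logderiv.
have say := logderiv_smooth iy sJ uJ.
have sPhi' mu := smooth_mx_pderiv mu sPhi.
have dB mu (F G : spacetime R -> 'M[C]_n) : smooth_mx F -> smooth_mx G ->
    pderiv mu (fun q => F q - G q) p = pderiv mu F p - pderiv mu G p.
  move=> sF sG; apply: is_mderive_pderiv.
  have -> : (fun q => F q - G q) = fun q => F q + -1 *: G q.
    by apply/funext => q; rewrite scaleN1r.
  have -> : pderiv mu F p - pderiv mu G p = pderiv mu F p + -1 *: pderiv mu G p.
    by rewrite scaleN1r.
  exact: is_mderiveD (smooth_is_mderive mu p sF)
    (is_mderiveZ _ (smooth_is_mderive mu p sG)).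
have flat := logderiv_flat it iy p sJ uJ.
cbv zeta.
have Et : pderiv it (logderiv it J) p =
          pderiv it (pderiv ix Phi) p - pderiv it (logderiv iy J) p :=
  etrans (congr1 (fun F => pderiv it F p) atE) (dB it _ _ (sPhi' ix) say).
have Ey : pderiv iy (logderiv it J) p =
          pderiv iy (pderiv ix Phi) p - pderiv iy (logderiv iy J) p :=
  etrans (congr1 (fun F => pderiv iy F p) atE) (dB iy _ _ (sPhi' ix) say).
have Ex : pderiv ix (logderiv ix J) p =
          pderiv it (pderiv ix Phi) p - pderiv iy (pderiv ix Phi) p.
  rewrite (pderivC it ix p sPhi) (pderivC iy ix p sPhi).
  exact: etrans (congr1 (fun F => pderiv ix F p) axE) (dB ix _ _ (sPhi' it) (sPhi' iy)).
(* With [a_mu] the logarithmic derivatives, eliminating the second derivatives of [Phi] leaves [d_y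
   a_t - d_t a_y - [a_t, a_y]], which vanishes by flatness in the [(t, y)] plane. *)
have alg (Att Axx Ayt X1 X2 X3 X4 Q1 Q2 : 'M[C]_n) : Att = X1 - X3 ->
    Ayt = X2 - X4 -> Axx = X1 - X2 -> X3 - Ayt = Q2 - Q1 ->
    Att - Axx - X4 - (Q1 - Q2) = 0.
  move=> -> -> -> /eqP; rewrite -subr_eq0 => /eqP Q.
  rewrite -[RHS]oppr0 -{}Q; apply/matrixP => i j; rewrite !mxE; ring.
exact: alg Et Ey Ex flat.
Qed.

Lemma root_norm1 (c z : C) k : (0 < n)%N -> z != 0 ->
  c ^+ n = (z / z^*) ^+ k -> c * c^* = 1.
Proof.
move=> n0 z0 cE; rewrite -normCK.
have := congr1 (fun x : C => `|x|) cE.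
rewrite !normrX normf_div norm_conjC divff ?normr_eq0 // expr1n => /eqP.
by rewrite pexpr_eq1 // => /eqP ->; rewrite expr1n.
Qed.

Lemma conj_ratio (z : C) : z != 0 -> (z^* / z) * (z^* / z)^* = 1.
Proof.
move=> z0; have zb0 : z^* != 0 by rewrite conjC_eq0.
by rewrite fmorph_div /= conjCK mulf_div [z * _]mulrC divff // mulf_neq0.
Qed.

(** The factor has determinant [conj z / z] to the power [k], which [c ^+ n] cancels; unitarity
    needs only that [c] and [conj z / z] have modulus 1. *)
Lemma SU_pencil (c z : C) k (J P : 'M[C]_n) : (0 < n)%N -> z != 0 ->
  c ^+ n = (z / z^*) ^+ k -> SU J -> herm_proj P -> \rank P = k ->
  SU (c *: (J *m pencil P (z^* / z))).
Proof.
move=> n0 z0 cE [uJ dJ] hP rP; have zb0 : z^* != 0 by rewrite conjC_eq0.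
split.
  have /unitarymxP uM : J *m pencil P (z^* / z) \is unitarymx.
    exact: mul_unitarymx uJ (pencil_unitary hP (conj_ratio z0)).
  apply/unitarymxP; rewrite trmxCZ -scalemxAl -scalemxAr uM scalerA.
  by rewrite (root_norm1 n0 z0 cE) scale1r.
rewrite detZ det_mulmx dJ mul1r det_pencil; last by case: hP.
by rewrite rP cE -exprMn mulf_div [z * z^*]mulrC divff ?mulf_neq0 // expr1n.
Qed.

Lemma ratio_cancel (F : fieldType) (x y : F) : x != 0 -> y != 0 ->
  y / x * ((0 - x) / (0 - y)) = 1.
Proof. by move=> x0 y0; rewrite !sub0r invrN mulrNN mulf_div [y * x]mulrC divff // mulf_neq0. Qed.

(** The constant [c0] absorbs the roots [c i] accumulated along the iteration; a constant scalar
    does not affect logarithmic derivatives. *)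
Definition associated psi J : Prop :=
  [/\ smooth_mx J, (forall p, SU (J p)) &
      exists c0 : C, forall p, J p *m psi p 0 = c0%:M].

Lemma backlund_associated (S : C -> Prop) c k z prj psi Phi J : (0 < n)%N ->
  extended_1soliton k z prj -> S z -> extended_solution S psi Phi ->
  c ^+ n = (z / z^*) ^+ k -> associated psi J ->
  associated (backlund_ext z prj psi) (backlund_map c z prj psi J).
Proof.
move=> n0 sol Sz ext cE [sJ SUJ [c0 Jpsi]].
have [sT hT] := ptilde_facts sol Sz ext.
have z0 := soliton_neq0 sol; have zb0 : z^* != 0 by rewrite conjC_eq0.
have JE : backlund_map c z prj psi J =
    fun p => c *: (J p *m pencil (ptilde z prj psi p) (z^* / z)).
  by apply/funext => p; rewrite /backlund_map addrC.
rewrite JE; split.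
- apply: smooth_mxZ; first exact: csmooth_cst.
  exact: smooth_mxM sJ (smooth_pencil _ sT).
- move=> p; have [hTp rT] := hT p.
  exact: SU_pencil n0 z0 cE (SUJ p) hTp rT.
- exists (c * c0) => p; have [[_ TT] _] := hT p.
  have key (J0 A B Psi : 'M[C]_n) : A *m B = 1%:M -> J0 *m Psi = c0%:M ->
      (c *: (J0 *m A)) *m (B *m Psi) = (c * c0)%:M.
    move=> AB JP; rewrite -scalemxAl mulmxA -[J0 *m A *m B]mulmxA AB mulmx1 JP.
    by rewrite scale_scalar_mx.
  apply: key (Jpsi p); rewrite -[X in _ *m X]/(pencil _ _) (pencilM _ _ TT).
  rewrite (ratio_cancel z0 zb0); exact: pencil1.
Qed.

Lemma associated_ward_map (S : C -> Prop) psi Phi J :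
  extended_solution S psi Phi -> S 0 -> associated psi J -> ward_map J.
Proof.
move=> [sPhi _ H] S0 [sJ SUJ [c0 Jpsi]]; have [spsi upsi lax1 lax2] := H 0 S0.
split=> //; apply: ward_equation_lax Jpsi lax1 lax2 => //.
by move=> p; apply: unitarymx_unit; have [] := SUJ p.
Qed.

End WardMaps.

(** * Periods *)

Section Periods.
Variable R : realType.
Local Notation C := (R[i]).
Implicit Types (s p : spacetime R) (z : C).

(** Translations by arbitrary vectors, since the spatial lattice vectors to be used combine [x] and
    [y]. *)
Definition invariant_under (T : Type) (F : spacetime R -> T) s : Prop :=
  forall p, F (p + s) = F p.

Lemma invariant_underD (T : Type) (F : spacetime R -> T) s s' :
  invariant_under F s -> invariant_under F s' -> invariant_under F (s + s').
Proof. by move=> Fs Fs' p; rewrite addrA Fs' Fs. Qed.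

Lemma invariant_underN (T : Type) (F : spacetime R -> T) s :
  invariant_under F s -> invariant_under F (- s).
Proof. by move=> Fs p; rewrite -Fs subrK. Qed.

Lemma invariant_underMn (T : Type) (F : spacetime R -> T) s (k : nat) :
  invariant_under F s -> invariant_under F (k%:R *: s).
Proof.
move=> Fs; elim: k => [|k IH]; first by move=> p; rewrite scale0r addr0.
by rewrite -natr1 scalerDl scale1r; exact: invariant_underD.
Qed.

Lemma invariant_underMz (T : Type) (F : spacetime R -> T) s (k : int) :
  invariant_under F s -> invariant_under F (k%:~R *: s).
Proof.
move=> Fs; case: k => k; first exact: invariant_underMn.
by rewrite NegzE mulrNz scaleNr; apply: invariant_underN; exact: invariant_underMn.
Qed.

Section ProjectionPeriods.
Variables (n k : nat) (z : C) (prj : spacetime R -> 'M[C]_n).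
Hypothesis sol : extended_1soliton k z prj.

Lemma invariant_wcoord s s' : wcoord z s = wcoord z s' ->
  invariant_under prj s -> invariant_under prj s'.
Proof.
move=> ss inv p; have [_ [V [P [_ _ _ prjE _]]]] := sol.
by rewrite prjE wcoordD -ss -wcoordD -prjE.
Qed.

(** As [z] is not real, [conj z / z] differs from 1 and the projection is recovered from the soliton
    map; periodicity of the map thus passes to the projection. *)
Lemma soliton_map_inj (c : C) p q : c != 0 ->
  soliton_map c z prj p = soliton_map c z prj q -> prj p = prj q.
Proof.
move=> c0; have [imz _] := sol; have z0 := soliton_neq0 sol.
have a1 : z^* / z - 1 != 0.
  rewrite subr_eq0; apply: contra imz => /eqP a1.
  have : z^* = z by rewrite -[LHS](divfK z0) a1 mul1r.
  move=> /(congr1 (fun x : C => complex.Im x)); rewrite Im_conjc => /eqP.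
  by rewrite -subr_eq0 -opprD oppr_eq0 -mulr2n mulrn_eq0.
rewrite /soliton_map => /(scalerI c0).
have E (P : 'M[C]_n) (a : C) : 1%:M - P + a *: P = 1%:M + (a - 1) *: P.
  by rewrite scalerBl scale1r addrAC addrA.
by rewrite !E => /addrI /(scalerI a1).
Qed.

End ProjectionPeriods.

(** * The time period of a doubly periodic soliton *)

Lemma calZ_modulus_gt0 z : calZ z -> 0 < modulus z.
Proof.
move=> [imz _]; rewrite lt_neqAle modulus_ge0 andbT eq_sym.
apply: contra imz => /eqP z0; have := normIm_modulus z.
by rewrite z0 normr_le0.
Qed.

Lemma modulus_sq z : modulus z ^+ 2 = complex.Re z ^+ 2 + complex.Im z ^+ 2.
Proof.
by case: z => a b; rewrite /modulus /= sqr_sqrtr // addr_ge0 // sqr_ge0.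
Qed.

Lemma Re_inv z : complex.Re z^-1 = complex.Re z / modulus z ^+ 2.
Proof. by rewrite modulus_sq; case: z. Qed.

Lemma Im_inv z : complex.Im z^-1 = - complex.Im z / modulus z ^+ 2.
Proof. by rewrite modulus_sq; case: z => a b /=; rewrite mulNr. Qed.

Lemma rat_ofP (a : R) : rational a -> ratr (rat_of a) = a.
Proof.
move=> [q _ qa]; apply: (@xgetPex _ 0 [set q : rat | ratr q = a]).
by exists q.
Qed.

Lemma modulus1_Re_neq0 z : calZ z -> modulus z = 1 -> complex.Re z != 0.
Proof.
move=> [_ cz] z1; case: cz => [[_ [zi zNi]]|[]//].
have := modulus_sq z; rewrite z1 expr1n.
case: z z1 zi zNi => a b /= _ zi zNi ab; apply/eqP => a0.
move: ab; rewrite a0 expr0n /= add0r => /esym/eqP; rewrite sqrf_eq1.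
by case/orP => /eqP b1; [apply: zi|apply: zNi]; rewrite a0 b1.
Qed.

Lemma modulus_sub_inv_neq0 (r : R) : 0 < r -> r <> 1 -> r - r^-1 != 0.
Proof.
move=> r0 r1; rewrite subr_eq0; apply/eqP => rr.
have : r ^+ 2 == 1 by rewrite expr2 {2}rr divff // gt_eqF.
rewrite sqrf_eq1 => /orP[/eqP//|/eqP rN1].
by move: r0; rewrite rN1 ltr0N1.
Qed.

Lemma period_neq0 z : calZ z -> period z != 0.
Proof.
move=> cz; have r0 := calZ_modulus_gt0 cz; rewrite /period.
case: ifPn => [/eqP r1|/eqP r1].
  have re0 := modulus1_Re_neq0 cz r1.
  by rewrite /cosarg r1 divr1 !mulf_neq0 ?invr_eq0 ?(gt_eqF (pi_gt0 _)).
rewrite !mulf_neq0 ?invr_eq0 ?(gt_eqF (pi_gt0 _)) //.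
- by rewrite intr_eq0 denq_neq0.
- by rewrite gt_eqF // addr_gt0 // invr_gt0.
- exact: modulus_sub_inv_neq0.
Qed.

(* The time translation by [period z] moves [w] by an element of the lattice
   spanned by the displacements of [w] along the two spatial periods. *)
Lemma wcoord_period z : calZ z -> exists m1 m2 : int,
  wcoord z (m1%:~R *: ((2 * pi) *: dir R ix) + m2%:~R *: ((2 * pi) *: dir R iy)) =
  wcoord z (period z *: dir R it).
Proof.
move=> cz; have r0 := calZ_modulus_gt0 cz.
have rn0 : modulus z != 0 by rewrite gt_eqF.
have half (x : C) : x / 2 = (2^-1)%:C%C * x by rewrite mulrC fmorphV rmorph_nat.
suff [m1 [m2 [Ere Eim]]] : exists m1 m2 : int,
    m1%:~R * (2 * pi) + m2%:~R * pi * (complex.Re z - complex.Re z^-1) =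
      period z / 2 * (complex.Re z + complex.Re z^-1) /\
    m2%:~R * pi * (complex.Im z - complex.Im z^-1) =
      period z / 2 * (complex.Im z + complex.Im z^-1).
  exists m1, m2; rewrite wcoordD !wcoordZ -!/(wdir z _) wdir_x wdir_y wdir_t !half.
  apply: complexP; rewrite !(Re_addc, Im_addc, Re_mulc, Im_mulc) /=.
  - rewrite !raddfN /= !(mul0r, mulr0, subr0, addr0, add0r, mulr1).
    by rewrite [RHS]mulrA -Ere; field.
  - rewrite !raddfN /= !(mul0r, mulr0, subr0, addr0, add0r, mulr1).
    by rewrite [RHS]mulrA -Eim; field.
rewrite !Re_inv !Im_inv /period; set r := modulus z in r0 rn0 *.
case: ifPn => [/eqP r1|/eqP r1].
  have re0 := modulus1_Re_neq0 cz r1.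
  (* On the unit circle [1/z] is the conjugate of [z], so the time shift moves [w] by
     [T cos theta = 2 pi]: one period in [x], none in [y]. *)
  exists 1, 0; rewrite /cosarg -/r r1 expr1n !divr1; split; last by field.
  by field.
have rr0 := modulus_sub_inv_neq0 r0 r1.
have [_ [[/r1//]|[_ rq]]] := cz.
(* [calZ] gives the rationality of half this number, so [rat_of] does not fall back on its default
   0. *)
have qE : ratr (rat_of (2 * cosarg z / (r - r^-1))) = 2 * cosarg z / (r - r^-1).
  apply: rat_ofP; case: rq => q _ qE; exists (2 * q) => //.
  by rewrite rmorphM /= qE rmorph_nat mulrA.
set Q := rat_of _ in qE *.
have m1E : (numq Q)%:~R = (denq Q)%:~R * (2 * cosarg z / (r - r^-1)) :> R.
  by rewrite -qE /ratr mulrC divfK // intr_eq0 denq_neq0.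
(* With [m2] the denominator, the imaginary part holds by the choice of [T]; as
   [(r + 1/r)^2 - (r - 1/r)^2 = 4], the real part then asks for [m1 = 2 m2 cos theta / (r - 1/r)],
   the numerator. *)
exists (numq Q), (denq Q); rewrite m1E /cosarg -/r.
have r21 : r ^+ 2 - 1 != 0.
  apply: contra rr0 => /eqP E; apply/eqP; apply: (mulfI rn0).
  by rewrite mulrBr divff // mulr0 -expr2.
split; field.
- by rewrite ?rn0 ?r21.
- by rewrite ?rn0 ?r21.
Qed.

Lemma soliton_time_period n k z (prj : spacetime R -> 'M[C]_n) :
  calZ z -> extended_1soliton k z prj ->
  invariant_under prj ((2 * pi) *: dir R ix) ->
  invariant_under prj ((2 * pi) *: dir R iy) ->
  invariant_under prj (period z *: dir R it).
Proof.
move=> cz sol ivx ivy; have [m1 [m2 E]] := wcoord_period cz.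
apply: (invariant_wcoord sol E).
by apply: invariant_underD; exact: invariant_underMz.
Qed.

(** [N] is built as the product of the numerators of the ratios [T j / T 0]. It is an integer of
    either sign, since the ratios may be negative. *)
Lemma common_period (T : nat -> R) (m : nat) :
  (forall j, (j <= m)%N -> T j != 0) ->
  (forall j, (1 <= j <= m)%N -> rational (T j / T 0%N)) ->
  exists2 N : int, N != 0 &
    forall j, (j <= m)%N -> exists l : int, N%:~R * T 0%N = l%:~R * T j.
Proof.
elim: m => [|m IH] T0 Trat.
  by exists 1 => // j; rewrite leqn0 => /eqP ->; exists 1.
have [j jm|j /andP[j1 jm]|N N0 HN] := IH.
- by apply: T0; exact: leqW.
- by apply: Trat; rewrite j1 leqW.
have [|q _ qE] := Trat m.+1; first by rewrite leqnn.
have T00 := T0 0%N isT; have Tm0 := T0 m.+1 (leqnn _).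
have q0 : q != 0.
  apply/eqP => q0; move: qE; rewrite q0 rmorph0 => /esym/eqP.
  by rewrite mulf_eq0 invr_eq0 (negPf T00) (negPf Tm0).
have E : (numq q)%:~R * T 0%N = (denq q)%:~R * T m.+1.
  have dq : (denq q)%:~R != 0 :> R by rewrite intr_eq0 denq_neq0.
  rewrite -[T m.+1](divfK T00) -qE /ratr mulrA; congr (_ * _).
  by rewrite mulrC divfK.
exists (N * numq q); first by rewrite mulf_neq0 // numq_eq0.
move=> j; rewrite leq_eqVlt => /orP[/eqP ->|].
  by exists (N * denq q); rewrite !intrM -!mulrA E.
rewrite ltnS => /HN[l lE]; exists (numq q * l).
by rewrite !intrM mulrAC lE mulrC mulrA.
Qed.

(** * Invariance and extended solutions along the iteration *)

Section Iteration.
Variables (n : nat) (c z : nat -> C) (P : nat -> spacetime R -> 'M[C]_n).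

Lemma ext_iter_invariant i s :
  (forall j, (j <= i)%N -> invariant_under (P j) s) ->
  invariant_under (ext_iter z P i) s.
Proof.
elim: i => [|i IH] Ps p; apply/funext => lambda /=.
  by rewrite (Ps 0%N).
have psiE : ext_iter z P i (p + s) = ext_iter z P i p.
  by apply: IH => j ji; apply: Ps; exact: leqW.
by rewrite /backlund_ext /ptilde psiE (Ps i.+1).
Qed.

Lemma ward_iter_invariant i s :
  (forall j, (j <= i)%N -> invariant_under (P j) s) ->
  invariant_under (ward_iter c z P i) s.
Proof.
elim: i => [|i IH] Ps p /=.
  by rewrite /soliton_map (Ps 0%N).
have Ps' j : (j <= i)%N -> invariant_under (P j) s by move=> ji; apply: Ps; exact: leqW.
by rewrite /backlund_map /ptilde (ext_iter_invariant Ps') (IH Ps') (Ps i.+1).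
Qed.

Lemma iter_extended_solution (k : nat -> nat) (m : nat) : (0 < n)%N ->
  (forall i j, (i <= m)%N -> (j <= m)%N -> i <> j ->
     z i <> z j /\ z i <> (z j)^*) ->
  (forall i, (i <= m)%N -> extended_1soliton (k i) (z i) (P i)) ->
  (forall i, (i <= m)%N -> c i ^+ n = (z i / (z i)^*) ^+ k i) ->
  forall i, (i <= m)%N ->
  (exists Phi, extended_solution
     (fun lambda => forall j, (j <= i)%N -> lambda <> z j /\ lambda <> (z j)^*)
     (ext_iter z P i) Phi) /\
  associated (ext_iter z P i) (ward_iter c z P i).
Proof.
move=> n0 hdist hsol hroot; elim=> [|i IH] im.
  have sol := hsol 0%N im.
  (* Against the trivial seed the projection is unchanged, so the base case is an instance of the
     general Backlund step. *)
  have tE : ptilde (z 0%N) (P 0%N) (fun _ _ => 1%:M) = P 0%N.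
    apply/funext => p; rewrite /ptilde mul1mx hproj_id //.
    by have [] := soliton_herm_proj p sol.
  have extE : ext_iter z P 0 = backlund_ext (z 0%N) (P 0%N) (fun _ _ => 1%:M).
    by apply/funext => p; apply/funext => lambda; rewrite /backlund_ext tE mulmx1.
  have wardE : ward_iter c z P 0 =
      backlund_map (c 0%N) (z 0%N) (P 0%N) (fun _ _ => 1%:M) (fun=> 1%:M).
    by apply/funext => p; rewrite /backlund_map tE mul1mx addrC.
  rewrite extE wardE; split.
    eexists; apply: extended_solution_sub
      (backlund_extended_solution sol I (@extended_solution1 R n)).
    by move=> lambda /(_ 0%N isT)[l1 l2]; split.
  apply: (backlund_associated n0 sol I (@extended_solution1 R n) (hroot 0%N im)).
  split; first exact: smooth_mx_cst.
    move=> p; split; last exact: det1.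
    by apply/unitarymxP; rewrite mul1mx trmxC1.
  by exists 1 => p; rewrite mulmx1.
have [[Phi ext] ass] := IH (ltnW im).
have sol := hsol _ im.
(* Distinctness of the poles places the new one in the admissible set of the previous extended
   solution. *)
have Sz j : (j <= i)%N -> z i.+1 <> z j /\ z i.+1 <> (z j)^*.
  move=> ji; apply: hdist => //; first exact: leq_trans ji (ltnW im).
  by move=> ij; move: ji; rewrite -ij ltnn.
split; last exact: backlund_associated n0 sol Sz ext (hroot _ im) ass.
eexists; apply: extended_solution_sub (backlund_extended_solution sol Sz ext).
move=> lambda Sl; have [l1 l2] := Sl i.+1 (leqnn _); split=> // j ji.
by apply: Sl; exact: leqW.
Qed.

End Iteration.

End Periods.

(** * Triple periodicity of the iterated Ward map *)

Theorem theorem3p2 (R : realType) (n m : nat) (k : nat -> nat)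
    (z c : nat -> R[i]) (P : nat -> 'rV[R]_3 -> 'M[R[i]]_n)
    (hZ : forall i, (i <= m)%N -> calZ (z i))
    (hdist : forall i j, (i <= m)%N -> (j <= m)%N -> i <> j ->
       z i <> z j /\ z i <> (z j)^*)
    (hsol : forall i, (i <= m)%N -> extended_1soliton (k i) (z i) (P i))
    (hroot : forall i, (i <= m)%N -> c i ^+ n = (z i / (z i)^*) ^+ k i)
    (hper : forall i, (i <= m)%N ->
       periodic_along (soliton_map (c i) (z i) (P i)) ix (2 * pi) /\
       periodic_along (soliton_map (c i) (z i) (P i)) iy (2 * pi))
    (hrat : forall j, (1 <= j <= m)%N ->
       rational (period (z j) / period (z 0%N))) :
  let J := ward_iter c z P m in
  [/\ ward_map J,
      periodic_along J ix (2 * pi),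
      periodic_along J iy (2 * pi) &
      exists2 T : R, 0 < T & periodic_along J it T].
Proof.
move=> J; have [n0|] := posnP n.
  move: n0 P hsol hroot hper @J => -> {n} P hsol hroot hper J.
  (* In size 0 all matrices coincide; this case is separate because the root condition bounds [c i]
     only for positive [n]. *)
  have flat (A B : 'M[R[i]]_0) : A = B by rewrite [A]flatmx0 [B]flatmx0.
  split; [split|by move=> p; exact: flat|by move=> p; exact: flat|].
  - by case.
  - move=> p; split; last exact: det_mx00.
    by apply/unitarymxP; exact: flat.
  - by move=> p; exact: flat.
  - by exists 1 => // p; exact: flat.
move=> n0.
have [[Phi ext] ass] := iter_extended_solution n0 hdist hsol hroot (leqnn m).
have z0 i : (i <= m)%N -> z i != 0 by move=> im; exact: soliton_neq0 (hsol i im).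
have c0 i : (i <= m)%N -> c i != 0.
  move=> im; apply/eqP => ci.
  have := root_norm1 n0 (z0 i im) (hroot i im); rewrite ci mul0r => /esym/eqP.
  by rewrite oner_eq0.
have ivx i : (i <= m)%N -> invariant_under (P i) ((2 * pi) *: dir R ix).
  move=> im p; have [H _] := hper i im.
  apply: (soliton_map_inj (hsol i im) (c0 i im)); exact: H.
have ivy i : (i <= m)%N -> invariant_under (P i) ((2 * pi) *: dir R iy).
  move=> im p; have [_ H] := hper i im.
  apply: (soliton_map_inj (hsol i im) (c0 i im)); exact: H.
split.
- apply: associated_ward_map ext _ ass => j jm; split; apply/eqP; rewrite eq_sym.
    exact: z0.
  by rewrite conjC_eq0 z0.
- exact: ward_iter_invariant ivx.
- exact: ward_iter_invariant ivy.
have [N N0 HN] := common_period (fun j jm => period_neq0 (hZ j jm)) hrat.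
(* An integer multiple of every [period (z j)], so it preserves all projections. It may be negative,
   whence the absolute value below. *)
pose T := N%:~R * period (z 0%N).
have T0 : T != 0.
  by rewrite mulf_neq0 ?intr_eq0 //; exact: period_neq0 (hZ 0%N isT).
have ivT : invariant_under J (T *: dir R it).
  apply: ward_iter_invariant => j jm; have [l lE] := HN j jm.
  rewrite /T lE -scalerA; apply: invariant_underMz.
  exact: soliton_time_period (hZ j jm) (hsol j jm) (ivx j jm) (ivy j jm).
exists `|T|; first by rewrite normr_gt0.
have [T0'|T0'] := leP 0 T; first by rewrite ger0_norm.
rewrite ltr0_norm // => p; rewrite scaleNr; exact: invariant_underN ivT p.
Qed.
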